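(* Let $(T_n)_{n\ge 1}$ be a uniform random recursive tree and let $R_n$ be the rumor rank of the root (vertex $1$) in $T_n$. Then $R_n$ is persistent: there exist integer-valued random variables $N,K$ with $\mathbb{P}(N<\infty)=\mathbb{P}(K<\infty)=1$ such that $R_n=K$ for all $n\ge N$.
   Context: A uniform random recursive tree (URRT) is a random sequence of trees $(T_n)_{n\ge 1}$ with $V(T_n)=[n]=\{1,\ldots,n\}$: $T_1$ is the single vertex $1$ (the root), and $T_{n+1}$ is obtained from $T_n$ by adding vertex $n+1$ and an edge $\{i,n+1\}$, where $i$ is chosen uniformly at random from $[n]$, independently of the past. For a tree $T$ and vertices $u,v$ of $T$, $(T,v)_{u\downarrow}$ denotes the subtree containing all vertices $w$ such that the path from $w$ to $v$ contains $u$ (rooted at $u$), and $|\cdot|$ denotes its number of vertices. The rumor centrality of $v\in V(T_n)$ is $\varphi_{T_n}(v)=\prod_{u\in V(T_n)\setminus\{v\}}|(T_n,v)_{u\downarrow}|$; smaller values correspond to more central vertices. Ranking: vertices are ordered from most to least central; vertices with equal centrality value are ordered in reverse order of insertion time (if $u,v$ have equal centrality, $u$ is ranked before $v$ iff $u>v$). This gives a permutation $\gamma_n$ of $[n]$, where $\gamma_n(v)\in\{1,\ldots,n\}$ is the position of $v$ in this order (position $1$ being most central). The rank of the root is $R_n=\gamma_n(1)$. *)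

(* Defs.v *)
From HB Require Import structures.
From mathcomp Require Import all_boot all_order all_algebra.
From mathcomp Require Import all_classical all_reals all_analysis.
From mathcomp Require Import measurable_realfun.

Set Implicit Arguments.
Unset Strict Implicit.
Unset Printing Implicit Defensive.

Import Order.TTheory GRing.Theory Num.Theory.

Local Open Scope classical_set_scope.
Local Open Scope ring_scope.

(* A finite graph whose vertices are natural numbers. *)
Record graph := Graph { vertices : seq nat; adj : rel nat }.

Definition single_vertex (v : nat) : graph :=
  Graph [:: v] (fun _ _ => false).

Definition add_leaf (T : graph) (j i : nat) : graph :=
  Graph (rcons (vertices T) j)
    (fun x y => [|| adj T x y, (x == i) && (y == j) | (x == j) && (y == i)]).

(* The vertices of the path are w :: p, in order from w to v. *)
Definition is_path (T : graph) (w v : nat) (p : seq nat) : Prop :=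
  [/\ path (adj T) w p, uniq (w :: p) & last w p = v].

(* Vertex list of (T, v)_{u \downarrow}; in a tree the path from w to v is
   unique, so it does not matter that p is existentially quantified. *)
Definition subtree (T : graph) (v u : nat) : seq nat :=
  [seq w <- vertices T | `[< exists2 p, is_path T w v p & u \in w :: p >]].

Definition rumor_centrality (T : graph) (v : nat) : nat :=
  (\prod_(u <- vertices T | u != v) size (subtree T v u))%N.

(* The non-strict version of "u is ranked before v", as needed by [sort]. *)
Definition ranked_before (T : graph) (u v : nat) : bool :=
  ((rumor_centrality T u < rumor_centrality T v)%N) ||
  ((rumor_centrality T u == rumor_centrality T v) && (v <= u)%N).

(* [index] counts from 0, ranks count from 1. *)
Definition rumor_rank (T : graph) (v : nat) : nat :=
  (index v (sort (ranked_before T) (vertices T))).+1.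

Section Processes.
Context (d : measure_display) (Omega : measurableType d) (R : realType).
Variable P : probability Omega R.

(* The sigma-algebra generated by c_1, ..., c_(n-1). *)
Definition past (c : nat -> {RV P >-> nat}) (n : nat) : set (set Omega) :=
  <<s \bigcup_(m in [set m | (1 <= m < n)%N])
        preimage_set_system setT (c m) measurable >>.

(* c_n is the vertex to which vertex n+1 is attached (c_0 is unused).  The trees
   T_1, ..., T_n and the choices c_1, ..., c_(n-1) determine each other. *)
Definition is_urrt (T : nat -> Omega -> graph) : Prop :=
  exists c : nat -> {RV P >-> nat},
    [/\ forall n w, (0 < n)%N -> (1 <= c n w <= n)%N,
        forall n i, (1 <= i <= n)%N ->
          P [set w | c n w = i] = (n%:R^-1)%:E,
        forall n (i : nat) A, (0 < n)%N -> past c n A ->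
          P ([set w | c n w = i] `&` A) = (P [set w | c n w = i] * P A)%E,
        forall w, T 1%N w = single_vertex 1
      & forall n w, (0 < n)%N -> T n.+1 w = add_leaf (T n w) n.+1 (c n w)].

Definition int_or_pinfty (x : \bar R) : Prop :=
  x = +oo%E \/ exists k : int, x = (k%:~R)%:E.

(* N and K may be infinite on a null event; where N is infinite the last
   clause is void. *)
Definition persistent (X : nat -> Omega -> nat) : Prop :=
  exists N K : {RV P >-> \bar R},
    [/\ forall w, int_or_pinfty (N w) /\ int_or_pinfty (K w),
        P [set w | (N w < +oo)%E] = 1%E,
        P [set w | (K w < +oo)%E] = 1%E
      & forall w n, (0 < n)%N -> (N w <= n%:R%:E)%E -> (X n w)%:R%:E = K w].

End Processes.

(* Main.v *)
Require Import Defs.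
From HB Require Import structures.
From mathcomp Require Import all_boot all_order all_algebra.
From mathcomp Require Import all_classical all_reals all_analysis.
From mathcomp Require Import measurable_realfun.
From mathcomp Require Import zify ring lra.

(* Write S(v) for the number of descendants of v in the tree on [N] rooted at 1.
   For v <> 1 with parent p one has phi(v) * S(v) = phi(p) * (N - S(v)), so with
   y(u) = S(u) / N the vertex v is at least as central as the root iff
   G(v) = prod_u y(u) - prod_u (1 - y(u)) >= 0, u running over the vertices <> 1
   of the path from the root to v.

   - S(v)(S(v)+1) / (N(N+1)) is a martingale started at 2 / (v(v+1)), which is
     summable; by Ville's inequality, for every e > 0 only finitely many v ever
     satisfy y(v) >= e.
   - Assign each of the N vertices to its last ancestor among the first v; the
     block sizes are uniform over the compositions of N into v parts.  Moving
     mass between the blocks of v and of its parent changes, among the S(u) on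
     the path, only S(v), so y(v) is unlikely to be near 0 or 1 and G(v) to be
     near 0.  Since (y(u) - a)^2 + 1/N is a supermartingale, they move
     little afterwards; hence almost surely y(v) stays away from 1 and the sign
     of G(v) is eventually constant.
   - The finitely many u with y(u) >= 1/2 contribute a bounded factor to
     prod_u y(u) / (1 - y(u)), so G(v) < 0 as soon as y(v) is small.  From some
     time on only a fixed finite set of vertices can compete with the root, and
     each of these comparisons is eventually constant. *)

Set Implicit Arguments.
Unset Strict Implicit.
Unset Printing Implicit Defensive.

Import Order.TTheory GRing.Theory Num.Theory.


(** * Recursive trees and rumor centrality *)

(* A history [:: c_n; ...; c_1] lists the parents of the vertices n+1, ..., 2 of
   a recursive tree on [n+1]. *)
Fixpoint valid (h : seq nat) : bool :=
  if h is i :: t then (0 < i <= (size t).+1) && valid t else true.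

Fixpoint rtree (h : seq nat) : graph :=
  if h is i :: t then add_leaf (rtree t) (size t).+2 i else single_vertex 1.

(** Read: [u] lies below [v], or equals it, in the tree rooted at 1. A new vertex is a leaf, so it
    is below [v] exactly when it is [v] itself or its parent is below [v]. *)
Fixpoint desc (h : seq nat) (v u : nat) : bool :=
  if h is i :: t then
    if u == (size t).+2 then (v == u) || desc t v i else desc t v u
  else (v == 1) && (u == 1).

(** The newest vertex is a leaf and can only be an end of a path; hence this recursion for the
    unique path from [w] to [v]. *)
Fixpoint tpath (h : seq nat) (w v : nat) : seq nat :=
  if h is i :: t then
    let j := (size t).+2 in
    if w == j then if v == j then [:: j] else j :: tpath t i v
    else if v == j then rcons (tpath t w i) j else tpath t w v
  else [:: 1].

Fixpoint par (h : seq nat) (v : nat) : nat :=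
  if h is i :: t then if v == (size t).+2 then i else par t v else 0.

(** The vertices other than 1 on the way from [v] up to the root, [v] included: the index set of the
    two products in G(v). *)
Fixpoint anc (h : seq nat) (v : nat) : seq nat :=
  if h is i :: t then
    if v == (size t).+2 then v :: anc t i else anc t v
  else [::].

Definition sub_size (h : seq nat) (v : nat) : nat :=
  count (desc h v) (iota 1 (size h).+1).

Lemma vertices_rtree h : vertices (rtree h) = iota 1 (size h).+1.
Proof.
elim: h => [//|i t IH].
rewrite [LHS]/= IH -cats1 -[(size (i :: t)).+1]addn1 (iotaD 1 (size t).+1 1).
by rewrite addn1 add1n.
Qed.

Lemma mem_vertices (h : seq nat) v : (v \in iota 1 (size h).+1) = (0 < v <= (size h).+1).
Proof. by rewrite mem_iota; lia. Qed.

Lemma adj_rtree h x y : valid h -> adj (rtree h) x y ->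
  (0 < x <= (size h).+1) && (0 < y <= (size h).+1).
Proof.
elim: h => [//|i t IH] /= /andP[Hi Ht] /or3P[/(IH Ht)||].
- lia.
- by move=> /andP[/eqP-> /eqP->]; lia.
- by move=> /andP[/eqP-> /eqP->]; lia.
Qed.

Lemma path_add_leaf T j i w p : j \notin w :: p ->
  path (adj (add_leaf T j i)) w p = path (adj T) w p.
Proof.
elim: p w => [//|x p IH] w; rewrite !inE !negb_or => /and3P[jw jx jp] /=.
rewrite IH ?inE ?negb_or ?jx //.
by rewrite [x == j]eq_sym [w == j]eq_sym (negbTE jw) (negbTE jx) andbF !orbF.
Qed.

(** The newest vertex is a leaf with sole neighbour [i]: a longer path with that end goes through
    [i], and any path avoiding it lives in the smaller tree. *)
Lemma is_path_tpath h w v p : valid h ->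
  0 < w <= (size h).+1 -> 0 < v <= (size h).+1 ->
  is_path (rtree h) w v p -> w :: p = tpath h w v.
Proof.
elim: h w v p => [|i t IH] w v p.
  move=> _ Hw Hv [] /=; case: p => [|x p] //= _ _ E.
  by have -> : w = 1 by simpl in *; lia.
move=> Hval Hw Hv [pp up lp]; have [Hi Ht] := andP Hval.
have adjj x : adj (rtree (i :: t)) x (size t).+2 -> x = i.
  rewrite /= => /or3P[/(adj_rtree Ht)||]; first lia.
    by case/andP => /eqP.
  by case/andP => /eqP -> /eqP; lia.
have jadj x : adj (rtree (i :: t)) (size t).+2 x -> x = i.
  rewrite /= => /or3P[/(adj_rtree Ht)||]; first lia.
    by case/andP => /eqP Ei; lia.
  by case/andP => _ /eqP.
have [wj|wj] := eqVneq w (size t).+2; have [vj|vj] := eqVneq v (size t).+2.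
- rewrite /= wj vj eqxx; case: p pp up lp => [//|x p] pp up lp.
  by move: up; rewrite /= wj -vj -lp /= mem_last.
- rewrite /= (negbTE vj) wj eqxx; case: p pp up lp => [|x p] pp up lp.
    by move: vj; rewrite -lp /= wj eqxx.
  move: pp; rewrite [path _ _ _]/= wj => /andP[/jadj xi pp].
  move: up; rewrite [uniq _]/= wj => /andP[jp up].
  congr cons; subst x; apply: IH => //; first by simpl in *; lia.
  by split => //; move: pp; rewrite path_add_leaf.
- rewrite /= vj eqxx (negbTE wj); case/lastP: p pp up lp => [|p x] pp up lp.
    by move: wj; rewrite -vj -lp eqxx.
  move: lp; rewrite last_rcons => xv; subst x.
  rewrite -rcons_cons vj; congr rcons.
  move: pp; rewrite rcons_path vj => /andP[pp /adjj li].
  move: up; rewrite -rcons_cons rcons_uniq vj => /andP[jp up].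
  apply: IH => //; first by simpl in *; lia.
  by split => //; move: pp; rewrite path_add_leaf.
- rewrite /= (negbTE vj) (negbTE wj).
  (* An inner visit to the leaf would be both preceded and followed by [i], against [uniq]. *)
  have jp : (size t).+2 \notin p.
    apply/negP => /splitPr E; case: E pp up lp => p1 [|x p2].
      by rewrite last_cat /= => _ _ E; move: vj; rewrite -E eqxx.
    rewrite cat_path => /andP[_]; rewrite [path _ _ _]/=.
    move=> /and3P[/adjj l1 /jadj x1 _].
    rewrite -cat_cons cat_uniq => /and3P[_ /hasPn/(_ i) H _] _.
    have /H : i \in [:: (size t).+2, x & p2] by rewrite x1 !inE eqxx orbT.
    by rewrite -{1}l1 mem_last.
  have jwp : (size t).+2 \notin w :: p by rewrite inE eq_sym negb_or wj.
  apply: IH => //; [by simpl in *; lia | by simpl in *; lia | ].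
  by split => //; move: pp; rewrite path_add_leaf.
Qed.

Lemma tpath_sub h w v : valid h -> 0 < w <= (size h).+1 ->
  0 < v <= (size h).+1 -> {subset tpath h w v <= iota 1 (size h).+1}.
Proof.
move=> Hh Hw Hv x; rewrite mem_vertices.
elim: h w v Hh Hw Hv => [|i t IH] w v /=.
  by move=> _ _ _; rewrite inE => /eqP->.
case/andP => Hi Ht Hw Hv.
case: eqVneq => wj; case: eqVneq => vj; rewrite ?mem_rcons ?inE.
- by move=> /eqP ->; lia.
- case/orP => [/eqP->|/IH]; first lia.
  move=> /(_ Ht); lia.
- case/orP => [/eqP->|/IH]; first lia.
  move=> /(_ Ht); lia.
- move/IH => /(_ Ht); lia.
Qed.

Lemma tpath_is_path h w v : valid h ->
  0 < w <= (size h).+1 -> 0 < v <= (size h).+1 ->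
  exists2 p, is_path (rtree h) w v p & w :: p = tpath h w v.
Proof.
elim: h w v => [|i t IH] w v.
  move=> _ Hw Hv; exists [::].
    by split => //; simpl in *; lia.
  by rewrite /=; congr [:: _]; simpl in *; lia.
move=> Hval Hw Hv; have [Hi Ht] := andP Hval.
have jn w' v' p : 0 < w' <= (size t).+1 -> 0 < v' <= (size t).+1 ->
    w' :: p = tpath t w' v' -> (size t).+2 \notin w' :: p.
  move=> Hw' Hv' ->; apply/negP => /(tpath_sub Ht Hw' Hv').
  by rewrite mem_vertices; lia.
rewrite [tpath _ _ _]/=.
have [wj|wj] := eqVneq w (size t).+2; have [vj|vj] := eqVneq v (size t).+2.
- by exists [::]; [split => //; rewrite wj | rewrite wj].
- have Hv' : 0 < v <= (size t).+1 by simpl in *; lia.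
  have [p [pp up lp] E] := IH i v Ht Hi Hv'.
  have jip := jn _ _ _ Hi Hv' E.
  exists (i :: p); last by rewrite wj E.
  split; last by [].
    rewrite [path _ _ _]/= path_add_leaf // pp andbT wj !eqxx !orbT //.
  by rewrite wj cons_uniq jip.
- have Hw' : 0 < w <= (size t).+1 by simpl in *; lia.
  have [p [pp up lp] E] := IH w i Ht Hw' Hi.
  have jip := jn _ _ _ Hw' Hi E.
  exists (rcons p v); last by rewrite -E vj.
  split; last by rewrite last_rcons.
    by rewrite rcons_path path_add_leaf // pp lp /= vj !eqxx orbT.
  by rewrite -rcons_cons rcons_uniq up vj jip.
- have Hw' : 0 < w <= (size t).+1 by simpl in *; lia.
  have Hv' : 0 < v <= (size t).+1 by simpl in *; lia.
  have [p [pp up lp] E] := IH w v Ht Hw' Hv'.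
  exists p => //; split => //.
  by rewrite path_add_leaf //; apply: jn E.
Qed.

Lemma tpath_uniq h w v : valid h ->
  0 < w <= (size h).+1 -> 0 < v <= (size h).+1 -> uniq (tpath h w v).
Proof. by move=> Hh Hw Hv; have [p [_ + _] <-] := tpath_is_path Hh Hw Hv. Qed.

Lemma subtreeE h v u : valid h -> 0 < v <= (size h).+1 ->
  subtree (rtree h) v u = [seq w <- iota 1 (size h).+1 | u \in tpath h w v].
Proof.
move=> Hh Hv; rewrite /subtree vertices_rtree; apply: eq_in_filter => w.
rewrite mem_vertices => Hw; apply/asboolP/idP => [[p /is_path_tpath ->]//|uw].
by have [p pp E] := tpath_is_path Hh Hw Hv; exists p => //; rewrite E.
Qed.

Lemma descxx h v : valid h -> 0 < v <= (size h).+1 -> desc h v v.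
Proof.
elim: h => [|i t IH] /=; first by move=> _; lia.
case/andP => Hi Ht Hv; rewrite eqxx; case: (eqVneq v _) => //= vj.
by apply: IH => //; lia.
Qed.

Lemma desc_ge h v u : valid h -> desc h v u ->
  (0 < v <= u) && (u <= (size h).+1).
Proof.
elim: h v u => [|i t IH] v u /=; first by move=> _ /andP[/eqP-> /eqP->].
case/andP => Hi Ht; case: eqVneq => [->|uj].
  by case/orP => [/eqP->|/(IH _ _ Ht)]; lia.
by move/(IH _ _ Ht); lia.
Qed.

Lemma par_range h v : valid h -> 1 < v <= (size h).+1 -> 0 < par h v < v.
Proof.
elim: h => [|i t IH] /=; first by lia.
by case/andP => Hi Ht Hv; case: eqVneq => [->|vj]; [lia|apply: IH => //; lia].
Qed.

Lemma tpath_self h v : valid h -> 0 < v <= (size h).+1 -> tpath h v v = [:: v].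
Proof.
elim: h => [|i t IH] /=; first by move=> _ Hv; congr [:: _]; lia.
by case/andP => Hi Ht Hv; case: eqVneq => [->//|vj]; apply: IH => //; lia.
Qed.

Lemma tpath_par h w v : valid h -> 0 < w <= (size h).+1 ->
  1 < v <= (size h).+1 ->
  if desc h v w then tpath h w (par h v) = rcons (tpath h w v) (par h v)
  else tpath h w v = rcons (tpath h w (par h v)) v.
Proof.
elim: h w => [|i t IH] w /=; first by lia.
case/andP => Hi Ht Hw Hv.
have dN x : desc t (size t).+2 x = false.
  by apply/negP => /(desc_ge Ht); lia.
case: (eqVneq v (size t).+2) => [->|vj].
  have -> : (i == (size t).+2) = false by lia.
  by rewrite !dN orbF; case: (eqVneq w (size t).+2) => _; rewrite ?eqxx ?tpath_self.
have Hp : 0 < par t v < v by apply: par_range => //; lia.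
have -> : (par t v == (size t).+2) = false by lia.
case: (eqVneq w (size t).+2) => [->|wj]; last by apply: IH => //; lia.
have Hv' : 1 < v <= (size t).+1 by lia.
by rewrite (negbTE vj) /=; have := IH i Ht Hi Hv'; case: ifP => _ ->.
Qed.

Lemma tpath_last_mem h w v : valid h -> 0 < w <= (size h).+1 ->
  0 < v <= (size h).+1 -> v \in tpath h w v.
Proof.
move=> Hh Hw Hv; have [p [_ _ <-] <-] := tpath_is_path Hh Hw Hv.
exact: mem_last.
Qed.

Lemma tpath_head_mem h w v : valid h -> 0 < w <= (size h).+1 ->
  0 < v <= (size h).+1 -> w \in tpath h w v.
Proof.
move=> Hh Hw Hv; have [p _ <-] := tpath_is_path Hh Hw Hv.
exact: mem_head.
Qed.

(** A subtree rooted at any third vertex looks the same from [v] and from its parent, so the two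
    products differ in one factor only: the parent's side of the edge, of size N - S(v), against the
    side of [v], of size S(v). *)
Lemma centrality_par h v : valid h -> 1 < v <= (size h).+1 ->
  rumor_centrality (rtree h) v * sub_size h v =
  rumor_centrality (rtree h) (par h v) * ((size h).+1 - sub_size h v).
Proof.
move=> Hh Hv; have Hp := par_range Hh Hv.
have Hv0 : 0 < v <= (size h).+1 by lia.
have Hp0 : 0 < par h v <= (size h).+1 by lia.
have vp : v != par h v by lia.
rewrite /rumor_centrality vertices_rtree.
have pin : par h v \in [seq u <- iota 1 (size h).+1 | u != v].
  by rewrite mem_filter mem_vertices Hp0 eq_sym vp.
have vin : v \in [seq u <- iota 1 (size h).+1 | u != par h v].
  by rewrite mem_filter mem_vertices Hv0 vp.
rewrite -big_filter (bigD1_seq _ pin) ?filter_uniq ?iota_uniq //.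
rewrite -[X in _ = X * _]big_filter.
rewrite [X in _ = X * _](bigD1_seq _ vin) ?filter_uniq ?iota_uniq //.
rewrite !big_filter_cond.
set A := \prod_(_ <- _ | _) _; set B := \prod_(_ <- _ | _) _.
have -> : A = B.
  rewrite /A /B; rewrite big_seq_cond [RHS]big_seq_cond.
  apply: eq_big => [u|u]; first by congr andb; exact: andbC.
  move=> /and3P[Hu uv up]; rewrite !subtreeE //; congr size.
  apply: eq_in_filter => w; rewrite mem_vertices => Hw.
  have := tpath_par Hh Hw Hv; case: ifP => _ ->.
    by rewrite mem_rcons inE (negbTE up).
  by rewrite mem_rcons inE (negbTE uv).
have -> : size (subtree (rtree h) (par h v) v) = sub_size h v.
  rewrite subtreeE // size_filter; apply: eq_in_count => w.
  rewrite mem_vertices => Hw; have := tpath_par Hh Hw Hv; case: ifP => _ E.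
    by rewrite E mem_rcons inE tpath_last_mem ?orbT.
  apply/negP => vw; have := tpath_uniq Hh Hw Hv0.
  by rewrite E rcons_uniq vw.
have -> : size (subtree (rtree h) v (par h v)) = (size h).+1 - sub_size h v.
  have EC := count_predC (desc h v) (iota 1 (size h).+1).
  rewrite size_iota in EC.
  rewrite subtreeE // size_filter /sub_size -[X in X - _]EC addKn; apply: eq_in_count => w.
  rewrite mem_vertices => Hw /=; have := tpath_par Hh Hw Hv; case: ifP => _ E.
    apply/negP => vw; have := tpath_uniq Hh Hw Hp0.
    by rewrite E rcons_uniq vw.
  by rewrite E mem_rcons inE tpath_last_mem ?orbT.
by rewrite mulnAC mulnC mulnA mulnAC [RHS]mulnAC; nia.
Qed.

Lemma centrality_gt0 h v : valid h -> 0 < v <= (size h).+1 ->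
  0 < rumor_centrality (rtree h) v.
Proof.
move=> Hh Hv; rewrite /rumor_centrality big_seq_cond prodn_cond_gt0 // => u.
rewrite vertices_rtree mem_vertices => /andP[Hu _].
rewrite subtreeE // size_filter -has_count; apply/hasP; exists u.
  by rewrite mem_vertices.
exact: tpath_head_mem.
Qed.

Lemma sub_size_cons i t v : sub_size (i :: t) v =
  sub_size t v + ((v == (size t).+2) || desc t v i).
Proof.
rewrite /sub_size -[(size (i :: t)).+1]addn1 (iotaD 1 (size t).+1 1) count_cat.
congr (_ + _).
  apply: eq_in_count => u; rewrite mem_vertices => Hu /=.
  by case: eqVneq => //; lia.
by rewrite /= add1n addn1 eqxx addn0.
Qed.

Lemma sub_size_gt0 h v : valid h -> 0 < v <= (size h).+1 -> 0 < sub_size h v.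
Proof.
move=> Hh Hv; rewrite -has_count; apply/hasP; exists v.
  by rewrite mem_vertices.
exact: descxx.
Qed.

Lemma sub_size_ltn h v : valid h -> 1 < v -> sub_size h v <= size h.
Proof.
move=> Hh Hv; rewrite /sub_size /=.
have -> : desc h v 1 = false by apply/negP => /(desc_ge Hh); lia.
by rewrite add0n -[leqRHS](size_iota 2) count_size.
Qed.

Lemma anc1 h : valid h -> anc h 1 = [::].
Proof. by elim: h => //= i t IH /andP[Hi Ht]; rewrite IH. Qed.

Lemma anc_par h v : valid h -> 1 < v <= (size h).+1 ->
  anc h v = v :: anc h (par h v).
Proof.
elim: h v => [|i t IH] v /=; first by lia.
case/andP => Hi Ht Hv; case: (eqVneq v (size t).+2) => [vj|vj].
  by have -> : (i == (size t).+2) = false by lia.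
have := @par_range t v Ht; move=> Hp; have -> : (par t v == (size t).+2) = false.
  by apply/negP => /eqP E; have := Hp; lia.
by rewrite IH //; lia.
Qed.

Lemma anc_ind h (Pr : nat -> Prop) : valid h -> Pr 1 ->
  (forall v, 1 < v <= (size h).+1 -> Pr (par h v) -> Pr v) ->
  forall v, 0 < v <= (size h).+1 -> Pr v.
Proof.
move=> Hh P1 PS; elim/ltn_ind => v IH Hv.
have [->//|v1] := eqVneq v 1.
have Hv1 : 1 < v <= (size h).+1 by lia.
by have := par_range Hh Hv1; move=> Hp; apply: PS => //; apply: IH; lia.
Qed.

Lemma anc_sub h v : valid h -> 0 < v <= (size h).+1 ->
  forall u, u \in anc h v -> (1 < u <= v).
Proof.
move=> Hh; move: v; apply: anc_ind => //; first by rewrite anc1.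
move=> v Hv IH u; rewrite anc_par // inE => /orP[/eqP->|/IH]; first lia.
have := par_range Hh Hv; lia.
Qed.

Lemma anc_uniq h v : valid h -> 0 < v <= (size h).+1 -> uniq (anc h v).
Proof.
move=> Hh; move: v; apply: anc_ind => //; first by rewrite anc1.
move=> v Hv IH; have Hp := par_range Hh Hv; rewrite anc_par //= IH andbT.
by apply/negP => /anc_sub; lia.
Qed.

Lemma size_anc h v : valid h -> 0 < v <= (size h).+1 -> size (anc h v) < v.
Proof.
move=> Hh; move: v; apply: anc_ind => //; first by rewrite anc1.
move=> v Hv IH; have Hp := par_range Hh Hv; rewrite anc_par //=; lia.
Qed.

Lemma desc_par h v x : valid h -> 1 < v <= (size h).+1 ->
  desc h v x -> desc h (par h v) x.
Proof.
elim: h v x => [|i t IH] v x /=; first by lia.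
case/andP => Hi Ht Hv.
have dN y : desc t (size t).+2 y = false.
  by apply/negP => /(desc_ge Ht); lia.
case: (eqVneq v (size t).+2) => [->|vj].
  case: (eqVneq x _) => [->|_]; last by rewrite dN.
  by rewrite descxx ?orbT.
case: (eqVneq x _) => [->|_]; last by apply: IH => //; lia.
rewrite (negbTE vj) /= => D; apply/orP; right; apply: IH => //; lia.
Qed.

Lemma desc_anc h v u x : valid h -> 0 < v <= (size h).+1 ->
  u \in anc h v -> desc h v x -> desc h u x.
Proof.
move=> Hh; move: v; apply: anc_ind => //; first by rewrite anc1.
move=> v Hv IH; rewrite anc_par // inE => /orP[/eqP->//|/IH H] /desc_par.
by move=> D; apply: H; apply: D.
Qed.

Lemma sub_size_anc h v u : valid h -> 0 < v <= (size h).+1 ->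
  u \in anc h v -> sub_size h v <= sub_size h u.
Proof.
by move=> Hh Hv Hu; apply: sub_count => x; apply: desc_anc.
Qed.

(** Histories grow at the head, so [t ++ h] is a later state of the tree [h]; the ancestors of a
    vertex are fixed when it is inserted. *)
Lemma anc_cat t h v : 0 < v <= (size h).+1 -> anc (t ++ h) v = anc h v.
Proof.
move=> Hv; elim: t => //= i t IH.
by case: eqVneq => // E; move: Hv; rewrite E size_cat; lia.
Qed.

Lemma valid_cat t h : valid (t ++ h) -> valid h.
Proof. by elim: t => //= i t IH /andP[_]. Qed.

(** Telescopes [centrality_par] along the path from [v] to the root. *)
Lemma centrality_anc h v : valid h -> 0 < v <= (size h).+1 ->
  rumor_centrality (rtree h) v * \prod_(u <- anc h v) sub_size h u =
  rumor_centrality (rtree h) 1 *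
    \prod_(u <- anc h v) ((size h).+1 - sub_size h u).
Proof.
move=> Hh; move: v; apply: anc_ind => //; first by rewrite anc1 // !big_nil.
move=> v Hv IH; rewrite anc_par // !big_cons mulnA centrality_par //.
by rewrite mulnAC IH mulnCA mulnC mulnA mulnAC.
Qed.

(** The condition G(v) >= 0 with denominators cleared. Equality counts in favour of [v], as in the
    tie-breaking rule. *)
Definition beats_root (h : seq nat) (v : nat) : bool :=
  \prod_(u <- anc h v) ((size h).+1 - sub_size h u) <=
  \prod_(u <- anc h v) sub_size h u.

Lemma centrality_le_root h v : valid h -> 0 < v <= (size h).+1 ->
  (rumor_centrality (rtree h) v <= rumor_centrality (rtree h) 1) =
  beats_root h v.
Proof.
move=> Hh Hv; have := centrality_anc Hh Hv; rewrite /beats_root.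
set a := rumor_centrality _ v; set b := rumor_centrality _ 1.
set p := \prod_(_ <- _) _; set q := \prod_(_ <- _) _ => E.
have a0 : 0 < a by apply: centrality_gt0.
have b0 : 0 < b by apply: centrality_gt0.
have p0 : 0 < p.
  rewrite /p big_seq prodn_cond_gt0 // => u /anc_sub Hu.
  by apply: sub_size_gt0 => //; have := Hu Hh Hv; lia.
have q0 : 0 < q by nia.
apply/idP/idP => H; nia.
Qed.

(** Cut the sorted list at [x]: all that stands before is related to [x], and antisymmetry forbids
    this for what stands after. *)
Lemma index_sort (T : eqType) (r : rel T) (s : seq T) (x : T) :
  total r -> transitive r -> antisymmetric r -> uniq s -> x \in s ->
  index x (sort r s) = count (fun u => r u x && (u != x)) s.
Proof.
move=> rtot rtr rasym us xs.
have -> : count (fun u => r u x && (u != x)) s =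
          count (fun u => r u x && (u != x)) (sort r s).
  by apply/permP; rewrite perm_sym perm_sort.
have := sort_sorted rtot s; rewrite (sorted_pairwise rtr).
have : x \in sort r s by rewrite mem_sort.
have : uniq (sort r s) by rewrite sort_uniq.
move: (sort r s) => s' us' /splitPr E; case: E us' => p1 p2.
rewrite cat_uniq /= negb_or => /and4P[_ /andP[xp1 _] xp2 _].
rewrite pairwise_cat /= => /and3P[/allrelP H1 _ /andP[/allP H2 _]].
rewrite index_cat (negbTE xp1) /= eqxx addn0 count_cat /= eqxx andbF add0n.
have -> : count (fun u => r u x && (u != x)) p1 = size p1.
  apply/eqP; rewrite -all_count; apply/allP => u up /=.
  rewrite (H1 u x) ?mem_head //=; apply: contra xp1 => /eqP <- //.
rewrite -[LHS]addn0; congr (_ + _); apply/esym/eqP; rewrite -leqn0 leqNgt -has_count.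
apply/hasPn => u up; apply/negP => /andP[rux ux].
by move/eqP: ux; apply; apply: rasym; rewrite rux H2.
Qed.

(** The root has the smallest label and loses every tie, so being ranked before it amounts to the
    non-strict inequality in [centrality_le_root]. *)
Lemma rumor_rank_root h : valid h -> rumor_rank (rtree h) 1 =
  (count (fun u => (u != 1) && beats_root h u) (iota 1 (size h).+1)).+1.
Proof.
move=> Hh; rewrite /rumor_rank vertices_rtree index_sort; first last.
- by rewrite mem_vertices.
- exact: iota_uniq.
- by move=> u v; rewrite /ranked_before; lia.
- by move=> u v w; rewrite /ranked_before; lia.
- by move=> u v; rewrite /ranked_before; lia.
congr S; apply: eq_in_count => u; rewrite mem_vertices => Hu.
by rewrite -centrality_le_root // /ranked_before; lia.
Qed.

(** * Averages over the growth of the tree *)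

(** [drop k h] is the tree as it was [k] insertions ago, so this says that [Phi] held at some time
    between size [m] and the present. *)
Definition ever (m : nat) (Phi : pred (seq nat)) (h : seq nat) : bool :=
  (m <= size h) && has (fun k => Phi (drop k h)) (iota 0 (size h - m).+1).

Lemma ever_cons m Phi i h : m <= size h ->
  ever m Phi (i :: h) = Phi (i :: h) || ever m Phi h.
Proof.
move=> mh; rewrite /ever mh [size _]/= leqW // subSn //.
have E : iota 1 (size h - m).+1 = map S (iota 0 (size h - m).+1).
  by rewrite -(iotaDl 1 0).
by rewrite -[(_ - _).+2]add1n iotaD E /= has_map.
Qed.

Lemma ever_size Phi h : ever (size h) Phi h = Phi h.
Proof. by rewrite /ever leqnn subnn /= drop0 orbF. Qed.

Lemma everP m Phi h : reflect
  (exists2 k, k <= size h - m & (m <= size h) && Phi (drop k h)) (ever m Phi h).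
Proof.
apply: (iffP andP) => [[mh /hasP[k kh Pk]]|[k kh /andP[mh Pk]]].
  by exists k; rewrite ?mh //; move: kh; rewrite mem_iota; lia.
by split => //; apply/hasP; exists k => //; rewrite mem_iota; lia.
Qed.

Local Open Scope ring_scope.

Section Averages.
Variable R : realFieldType.
Implicit Types (f g : seq nat -> R) (h : seq nat).

(* Conditional expectation of f, given h, after j further insertions. *)
Fixpoint mean (j : nat) f h : R :=
  if j is j'.+1 then
    (\sum_(1 <= i < (size h).+2) mean j' f (i :: h)) / (size h).+1%:R
  else f h.

Definition ind (Phi : pred (seq nat)) h : R := (Phi h)%:R.

Lemma nv_gt0 h : 0 < (size h).+1%:R :> R. Proof. by rewrite ltr0n. Qed.

Lemma mean_le j f g h : valid h ->
  (forall t, size t = j -> valid (t ++ h) -> f (t ++ h) <= g (t ++ h)) ->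
  mean j f h <= mean j g h.
Proof.
elim: j h => [|j IH] h Hh fg /=; first exact: (fg [::]).
rewrite ler_pM2r ?invr_gt0 ?nv_gt0 //; apply: ler_sum_nat => i Hi.
apply: IH => [|t st Ht] /=; first by rewrite Hh andbT; lia.
by move: (fg (rcons t i)); rewrite cat_rcons; apply=> //; rewrite size_rcons st.
Qed.

Lemma mean_cst j c h : mean j (fun=> c) h = c.
Proof.
elim: j h => [//|j IH] h /=.
under eq_bigr do rewrite IH.
by rewrite big_const_nat subn1 iter_addr_0 -[c *+ _]mulr_natr mulfK // gt_eqF ?nv_gt0.
Qed.

Lemma meanD j f g h : mean j (fun h => f h + g h) h = mean j f h + mean j g h.
Proof.
elim: j h => [//|j IH] h /=.
by under eq_bigr do rewrite IH; rewrite big_split mulrDl.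
Qed.

Lemma meanZ j c f h : mean j (fun h => c * f h) h = c * mean j f h.
Proof.
elim: j h => [//|j IH] h /=.
by under eq_bigr do rewrite IH; rewrite -mulr_sumr mulrA.
Qed.

Lemma mean_sum j (I : Type) (s : seq I) (P : pred I) (F : I -> seq nat -> R) h :
  mean j (fun h => \sum_(x <- s | P x) F x h) h =
  \sum_(x <- s | P x) mean j (F x) h.
Proof.
elim: j h => [//|j IH] h /=.
by under eq_bigr do rewrite IH; rewrite exchange_big /= mulr_suml.
Qed.

Lemma mean_add j k f h : mean (j + k) f h = mean j (mean k f) h.
Proof. by elim: j h => [//|j IH] h /=; under eq_bigr do rewrite IH. Qed.

(* Ville's inequality for f, a nonnegative supermartingale from h0 on. *)
Lemma mean_ever_le (f : seq nat -> R) (Phi : pred (seq nat)) (lam : R) h0 j :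
  0 < lam -> valid h0 ->
  (forall t, valid (t ++ h0) -> 0 <= f (t ++ h0)) ->
  (forall t, valid (t ++ h0) ->
     \sum_(1 <= i < (size (t ++ h0)).+2) f (i :: (t ++ h0)) <=
       (size (t ++ h0)).+1%:R * f (t ++ h0)) ->
  (forall t, valid (t ++ h0) -> Phi (t ++ h0) -> lam <= f (t ++ h0)) ->
  mean j (ind (ever (size h0) Phi)) h0 <= f h0 / lam.
Proof.
move=> lam0 Hh0 f0 fS fP.
(* Optional stopping by induction: only histories on which [Phi] has not occurred before the last
   insertion are followed. *)
suff main t : valid (t ++ h0) ->
    (t = [::] \/ ~~ ever (size h0) Phi (behead (t ++ h0))) ->
    mean j (ind (ever (size h0) Phi)) (t ++ h0) <= f (t ++ h0) / lam.
  by apply: (main [::]) => //; left.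
elim: j t => [|j IH] t Ht nev.
  rewrite /= /ind.
  have -> : ever (size h0) Phi (t ++ h0) = Phi (t ++ h0).
    case: nev => [->|]; first exact: ever_size.
    case: t Ht => [|i t] Ht; first by rewrite ever_size.
    by move=> /negbTE /= E; rewrite ever_cons ?E ?orbF // size_cat leq_addl.
  rewrite ler_pdivlMr //; case: (boolP (Phi _)) => [/fP|_]; rewrite ?mul1r ?mul0r.
    exact.
  exact: f0.
(* At the first occurrence of [Phi] the bound is trivial, since f / lam is already at least 1;
   before it, the supermartingale inequality is used. *)
have [PT|nP] := boolP (Phi (t ++ h0)).
  apply: (@le_trans _ _ 1).
    rewrite -[leRHS](mean_cst j.+1 1 (t ++ h0)); apply: mean_le => // t' _ _.
    by rewrite /ind lern1 leq_b1.
  by rewrite ler_pdivlMr // mul1r fP.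
rewrite [mean _ _ _]/= ler_pdivrMr ?nv_gt0 // -mulrA [lam^-1 * _]mulrC mulrA.
rewrite ler_pdivlMr // [leRHS]mulrC.
apply: le_trans (fS _ Ht); rewrite mulr_suml; apply: ler_sum_nat => i Hi.
rewrite -ler_pdivlMr //; apply: (IH (i :: t)); first by rewrite /= Ht andbT; lia.
right; rewrite /=; case: nev => [t0|].
  by subst t; rewrite ever_size.
case: t Ht nP {Hi} => [|x t] Ht nP; first by rewrite ever_size.
by move=> /negbTE /= E; rewrite ever_cons ?E ?orbF // size_cat leq_addl.
Qed.

Lemma sum_desc h v (a b : R) : valid h ->
  \sum_(1 <= i < (size h).+2) (if desc h v i then a else b) =
  (sub_size h v)%:R * a + ((size h).+1%:R - (sub_size h v)%:R) * b.
Proof.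
move=> Hh; rewrite /index_iota subn1 /=.
rewrite (bigID (desc h v)) /=.
rewrite (eq_bigr (fun=> a)) => [|i ->//].
rewrite [X in _ + X](eq_bigr (fun=> b)) => [|i /negbTE ->//].
rewrite !big_const_seq !iter_addr_0 -[a *+ _]mulr_natl -[b *+ _]mulr_natl; congr (_ + _ * _).
have := count_predC (desc h v) (iota 1 (size h).+1).
by rewrite size_iota => <-; rewrite natrD addrC addKr.
Qed.

End Averages.

(** * Maximal inequalities for subtree sizes *)

Section MaximalBounds.
Variable R : realFieldType.
Implicit Types h : seq nat.

Lemma sub_size_le h v : (sub_size h v <= (size h).+1)%N.
Proof. by rewrite -[leqRHS](size_iota 1) count_size. Qed.

Lemma sub_size0 h v : valid h -> ((size h).+1 < v)%N -> sub_size h v = 0%N.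
Proof.
move=> Hh Hv; apply/eqP; rewrite -leqn0 leqNgt -has_count; apply/hasPn => u _.
by apply/negP => /(desc_ge Hh); lia.
Qed.

(** One step of a Polya urn: S(v) of the N possible parents lie below [v], and those raise S(v) by
    one. *)
Lemma sum_sub_size_cons h v (F : nat -> R) : valid h -> (v <= (size h).+1)%N ->
  \sum_(1 <= i < (size h).+2) F (sub_size (i :: h) v) =
  (sub_size h v)%:R * F (sub_size h v).+1 +
  ((size h).+1%:R - (sub_size h v)%:R) * F (sub_size h v).
Proof.
move=> Hh Hv; rewrite -sum_desc //; apply: eq_bigr => i _.
rewrite sub_size_cons; have -> : (v == (size h).+2) = false by lia.
by case: desc; rewrite ?addn1 ?addn0.
Qed.

Lemma sum_nat_cst (n : nat) (c : R) :
  \sum_(1 <= i < n.+2) c = n.+1%:R * c.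
Proof. by rewrite big_const_nat subn1 iter_addr_0 -[c *+ _]mulr_natl. Qed.

(** A history of length [m] has m + 1 vertices, so labels from [m.+2] on are those inserted later;
    one of them has share at least 1/q. *)
Definition late_large (m q : nat) h : bool :=
  has (fun v => ((size h).+1 <= q * sub_size h v)%N)
      (index_iota m.+2 (size h).+2).

Lemma mean_late_large (q : nat) h0 j : (0 < q)%N -> valid h0 ->
  mean j (ind R (ever (size h0) (late_large (size h0) q))) h0 <=
  (2 / (size h0).+2%:R) / (2 * q%:R ^+ 2)^-1.
Proof.
move=> q0 Hh0; set m := size h0.
pose sq h v : R := (sub_size h v)%:R * (sub_size h v).+1%:R /
  ((size h).+1%:R * (size h).+2%:R).
(* The last term is the sum of the starting values 2 / (v(v+1)) over all vertices still to come; it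
   makes [f] a martingale. *)
pose f h := \sum_(m.+2 <= v < (size h).+2) sq h v + 2 / (size h).+2%:R.
have sq_ge0 h v : 0 <= sq h v by rewrite divr_ge0 // mulr_ge0.
have f_ge0 h : 0 <= f h by rewrite addr_ge0 ?divr_ge0 ?sumr_ge0.
have -> : 2 / m.+2%:R = f h0 by rewrite /f big_geq // add0r.
have q0R : 0 < q%:R :> R by rewrite ltr0n.
apply: mean_ever_le => //.
- by rewrite invr_gt0 mulr_gt0 // exprn_gt0.
- move=> t Ht; have mh : (m <= size (t ++ h0))%N by rewrite size_cat leq_addl.
  move: (t ++ h0) Ht mh => h Hh mh; rewrite /f big_split /= exchange_big /=.
  rewrite !sum_nat_cst big_nat_recr ?ltnS //=.
  have -> : \sum_(1 <= i < (size h).+2) sq (i :: h) (size h).+2 =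
      (size h).+1%:R * (2 / ((size h).+2%:R * (size h).+3%:R)).
    under eq_bigr do rewrite /sq sub_size_cons eqxx sub_size0 //= mul1r.
    by rewrite sum_nat_cst.
  have -> : \sum_(m.+2 <= v < (size h).+2) \sum_(1 <= i < (size h).+2)
      sq (i :: h) v = (size h).+1%:R * \sum_(m.+2 <= v < (size h).+2) sq h v.
    rewrite mulr_sumr; apply: eq_big_nat => v Hv.
    rewrite (sum_sub_size_cons (fun s => s%:R * s.+1%:R /
      ((size h).+2%:R * (size h).+3%:R))) //; last by lia.
    rewrite /sq; move: (sub_size h v) (size h) => s n.
    rewrite -!natr1; field.
    by rewrite !natr1 !pnatr_eq0.
  rewrite -!mulrDr -addrA ler_pM2l ?nv_gt0 // lerD2l.
  move: (size h) => n; rewrite le_eqVlt; apply/orP; left; apply/eqP; rewrite -!natr1; field.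
  by rewrite !natr1 !pnatr_eq0.
- move=> t Ht; move: (t ++ h0) Ht => h Hh /hasP[v].
  rewrite mem_index_iota => Hv HS; rewrite /f.
  (* From S(v) >= N/q; the factor 2 absorbs N + 1 <= 2N. *)
  have : (2 * q%:R ^+ 2)^-1 <= sq h v.
    rewrite /sq ler_pdivlMr ?mulr_gt0 ?ltr0n // ler_pdivrMl; last first.
      by rewrite mulr_gt0 // exprn_gt0.
    rewrite -!(natrX, natrM) ler_nat; nia.
  move/le_trans; apply.
  rewrite (bigD1_seq v) ?iota_uniq ?mem_index_iota //= -addrA lerDl.
  by rewrite addr_ge0 ?divr_ge0 ?sumr_ge0.
Qed.

Definition share h v : R := (sub_size h v)%:R / (size h).+1%:R.

Definition drifted (l : seq nat) (del : R) h0 h : bool :=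
  has (fun u => del <= `|share h u - share h0 u|) l.

Lemma share_ge0 h v : 0 <= share h v. Proof. by rewrite divr_ge0. Qed.

Lemma share_le1 h v : share h v <= 1.
Proof. by rewrite ler_pdivrMr ?nv_gt0 // mul1r ler_nat sub_size_le. Qed.

Lemma mean_drifted (l : seq nat) (del : R) h0 j : 0 < del -> valid h0 ->
  (forall u, u \in l -> (u <= (size h0).+1)%N) ->
  mean j (ind R (ever (size h0) (drifted l del h0))) h0 <=
  ((size l)%:R / (size h0).+1%:R) / del ^+ 2.
Proof.
move=> del0 Hh0 Hl.
(* A step adds y(1 - y) / (N+1)^2 to the mean of the square, less than the drop 1 / (N(N+1)) of the
   second term. *)
pose f h := \sum_(u <- l) ((share h u - share h0 u) ^+ 2 + (size h).+1%:R^-1).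
have -> : (size l)%:R / (size h0).+1%:R = f h0.
  rewrite /f; under eq_bigr do rewrite subrr expr0n add0r.
  by rewrite big_const_seq iter_addr_0 count_predT -[RHS]mulr_natl.
have t_ge0 h u : 0 <= (share h u - share h0 u) ^+ 2 + (size h).+1%:R^-1.
  by rewrite addr_ge0 ?sqr_ge0 ?invr_ge0.
apply: mean_ever_le => //.
- by rewrite exprn_gt0.
- by move=> t _; rewrite sumr_ge0.
- move=> t Ht; have mh : (size h0 <= size (t ++ h0))%N by rewrite size_cat leq_addl.
  move: (t ++ h0) Ht mh => h Hh mh; rewrite /f exchange_big mulr_sumr /=.
  rewrite big_seq [leRHS]big_seq; apply: ler_sum => u /Hl Hu.
  rewrite (sum_sub_size_cons (fun s => (s%:R / (size h).+2%:R - share h0 u)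
    ^+ 2 + (size h).+2%:R^-1)) //; last by lia.
  have := sub_size_le h u; rewrite /share; move: (_ / (size h0).+1%:R) => a.
  move: (sub_size h u) (size h) => s n sn.
  rewrite -subr_ge0.
  have -> : n.+1%:R * ((s%:R / n.+1%:R - a) ^+ 2 + n.+1%:R^-1) -
    (s%:R * ((s.+1%:R / n.+2%:R - a) ^+ 2 + n.+2%:R^-1) +
     (n.+1%:R - s%:R) * ((s%:R / n.+2%:R - a) ^+ 2 + n.+2%:R^-1)) =
    (n.+1%:R * n.+2%:R - s%:R * (n.+1%:R - s%:R)) / (n.+1%:R * n.+2%:R ^+ 2).
    rewrite -!natr1; field.
    by rewrite !natr1 !pnatr_eq0.
  apply: divr_ge0; last by rewrite mulr_ge0 // exprn_ge0.
  rewrite subr_ge0 -natrB // -!natrM ler_nat; nia.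
- move=> t Ht /hasP[u ul Hu]; rewrite /f (big_rem u) //=.
  apply: (@le_trans _ _ ((share (t ++ h0) u - share h0 u) ^+ 2)).
    by rewrite -[leRHS]real_normK ?num_real // lerXn2r // nnegrE ltW.
  by rewrite -addrA lerDl addr_ge0 ?invr_ge0 ?sumr_ge0.
Qed.

End MaximalBounds.

(** * Anticoncentration *)

(* The last ancestor of u, possibly u itself, among the first m.+1 vertices. *)
Fixpoint early_anc (m : nat) (h : seq nat) (u : nat) : nat :=
  if h is i :: t then
    if (size t < m)%N then u
    else if u == (size t).+2 then early_anc m t i else early_anc m t u
  else u.

(* The index l : 'I_m.+1 stands for the vertex l.+1. *)
Definition blocks (m : nat) (h : seq nat) : {ffun 'I_m.+1 -> nat} :=
  [ffun l : 'I_m.+1 => count (fun u => early_anc m h u == l.+1) (iota 1 (size h).+1)].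

Section Blocks.
Local Open Scope nat_scope.
Implicit Types h t : seq nat.

Lemma early_anc_id m h u : size h <= m -> early_anc m h u = u.
Proof. by case: h => //= i t ->. Qed.

Lemma early_anc_range m h u : valid h -> m <= size h ->
  0 < u <= (size h).+1 -> 0 < early_anc m h u <= m.+1.
Proof.
elim: h u => [|i t IH] u; first by case: m => //=; lia.
case/andP => Hi Ht; rewrite leq_eqVlt => /orP[/eqP->|mt] Hu.
  by rewrite early_anc_id.
have {}mt : m <= size t by [].
rewrite /= [size t < m]ltnNge mt /=.
by case: eqVneq => uj; apply: IH => //; move: Hu => /=; lia.
Qed.

Lemma blocks_cons m i h l : m <= size h -> 0 < i <= (size h).+1 ->
  blocks m (i :: h) l = blocks m h l + (early_anc m h i == l.+1).
Proof.
move=> mh Hi; rewrite !ffunE -[(size (i :: h)).+1]addn1.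
rewrite (iotaD 1 (size h).+1 1) count_cat; congr (_ + _).
  apply: eq_in_count => u; rewrite mem_vertices => Hu /=.
  by rewrite [size h < m]ltnNge mh /=; case: (eqVneq u (size h).+2) => //; lia.
by rewrite /= [size h < m]ltnNge mh add1n eqxx addn0.
Qed.

Lemma blocks_base h l : blocks (size h) h l = 1.
Proof.
rewrite ffunE (eq_count (a2 := pred1 (l.+1 : nat))) => [|u].
  by rewrite count_uniq_mem ?iota_uniq // mem_vertices ltn_ord.
by rewrite early_anc_id.
Qed.

Lemma sum_blocks m h (P : pred nat) : valid h -> m <= size h ->
  \sum_(l < m.+1 | P l.+1) blocks m h l =
  count (fun u => P (early_anc m h u)) (iota 1 (size h).+1).
Proof.
move=> Hh mh; under eq_bigr do rewrite ffunE -sum1_count big_mkcond.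
rewrite exchange_big -sum1_count [RHS]big_mkcond.
rewrite big_seq [RHS]big_seq; apply: eq_bigr => u; rewrite mem_vertices => Hu.
have Hr := early_anc_range Hh mh Hu.
have Hr' : (early_anc m h u).-1 < m.+1 by lia.
rewrite [LHS]/= -big_mkcondr sum1_card /=.
case: ifP => Pr.
  rewrite (eq_card (B := pred1 (Ordinal Hr'))) ?card1 // => l.
  rewrite !inE unfold_in -(inj_eq val_inj) /=.
  apply/andP/eqP => [[_ /eqP E]|E]; first by rewrite E.
  by rewrite E prednK ?Pr //; lia.
apply: eq_card0 => l; rewrite unfold_in; apply/andP => -[Pl /eqP E].
by rewrite E Pl in Pr.
Qed.

Lemma sum_blocksT m h : valid h -> m <= size h ->
  \sum_(l < m.+1) blocks m h l = (size h).+1.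
Proof.
by move=> Hh mh; rewrite (sum_blocks xpredT) // count_predT size_iota.
Qed.

Lemma desc_early_anc t h w u : valid (t ++ h) -> w <= (size h).+1 ->
  0 < u <= (size (t ++ h)).+1 ->
  desc (t ++ h) w u = desc h w (early_anc (size h) (t ++ h) u).
Proof.
elim: t u => [|i t IH] u; first by rewrite cat0s early_anc_id.
rewrite cat_cons => /andP[Hi Ht] Hw Hu /=.
rewrite [size (t ++ h) < _]ltnNge size_cat leq_addl /= -size_cat.
case: eqVneq => uj.
  rewrite -IH //; case: eqVneq => // E.
  by move: Hw; rewrite E uj size_cat; lia.
by apply: IH => //; move: Hu => /=; lia.
Qed.

(** Later growth enters the sizes S(w) of early vertices through the block sizes alone; which blocks
    count for [w] is fixed by [h]. *)
Lemma sub_size_blocks t h w : valid (t ++ h) -> w <= (size h).+1 ->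
  sub_size (t ++ h) w =
  \sum_(l < (size h).+1 | desc h w l.+1) blocks (size h) (t ++ h) l.
Proof.
move=> Ht Hw; rewrite (sum_blocks (desc h w)) //; last by rewrite size_cat leq_addl.
apply: eq_in_count => u; rewrite mem_vertices => Hu.
exact: desc_early_anc.
Qed.

Lemma blocks_gt0 t h l : valid (t ++ h) -> 0 < blocks (size h) (t ++ h) l.
Proof.
elim: t => [|i t IH]; first by rewrite blocks_base.
case/andP => Hi Ht; rewrite cat_cons blocks_cons //; last by rewrite size_cat leq_addl.
by rewrite addn_gt0 IH.
Qed.

End Blocks.

Section Uniform.
Variable R : realFieldType.
Implicit Types h t : seq nat.

(** There are C(m+j, m) compositions of m+j+1 into m+1 positive parts, and each has probability at
    most the inverse of this number. Induction over the last insertion: it enlarged some block [l]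
    from z(l) - 1 to z(l), with probability (z(l) - 1) / (m+j+1) given the previous vector. *)
Lemma mean_blocks_le h0 j (z : {ffun 'I_(size h0).+1 -> nat}) : valid h0 ->
  mean j (ind R (fun h => blocks (size h0) h == z)) h0 *
    'C(size h0 + j, size h0)%:R <= 1.
Proof.
move=> Hh0; set m := size h0 in z *; elim: j z => [|j IH] z.
  by rewrite addn0 binn mulr1 /= /ind lern1 leq_b1.
(* Vectors with an empty block or a wrong total have probability 0. *)
have [/andP[/forallP z0 /eqP zs]|nz] :=
    boolP ([forall l, 0 < z l] && (\sum_l z l == m + j.+2))%N; last first.
  rewrite (_ : mean _ _ _ = 0) ?mul0r //; apply/eqP; rewrite eq_le.
  apply/andP; split; rewrite -[X in _ <= X](mean_cst j.+1 0 h0) ||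
    rewrite -[X in X <= _](mean_cst j.+1 0 h0); apply: mean_le => // t st Ht;
    rewrite /ind // (_ : _ == z = false) //.
  apply: contraNF nz => /eqP <-; apply/andP; split.
    by apply/forallP => l; apply: blocks_gt0.
  by rewrite sum_blocksT // size_cat ?leq_addl // st; apply/eqP; rewrite /m; lia.
pose zm (l : 'I_m.+1) : {ffun 'I_m.+1 -> nat} :=
  [ffun k => if k == l then (z k).-1 else z k].
rewrite -[in mean _ _ _](addn1 j) mean_add.
have step : mean j (mean 1 (ind R (fun h => blocks m h == z))) h0 <=
    mean j (fun h => \sum_l ((z l).-1%:R / (m + j.+1)%:R) *
       ind R (fun h => blocks m h == zm l) h) h0.
  apply: mean_le => // t st Ht.
  have mt : (m <= size (t ++ h0))%N by rewrite size_cat leq_addl.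
  have sE : (size (t ++ h0)).+1 = (m + j.+1)%N by rewrite size_cat st /m; lia.
  move: (t ++ h0) Ht mt sE => h Hh mh sE; rewrite /= sE.
  rewrite mulr_suml; rewrite -sE.
  have -> : \sum_l (z l).-1%:R / (size h).+1%:R * ind R (fun h => blocks m h == zm l) h =
    (\sum_l (z l).-1%:R * ind R (fun h => blocks m h == zm l) h) / (size h).+1%:R.
    by rewrite mulr_suml; apply: eq_bigr => l _; rewrite mulrAC.
  rewrite -mulr_suml ler_pM2r ?invr_gt0 ?nv_gt0 //.
  have Hl i : (1 <= i < (size h).+2)%N -> ((early_anc m h i).-1 < m.+1)%N.
    by move=> Hi; have := early_anc_range Hh mh Hi; lia.
  apply: (@le_trans _ _ (\sum_(1 <= i < (size h).+2)
      \sum_(l < m.+1 | early_anc m h i == l.+1)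
      ind R (fun h => blocks m h == zm l) h)).
    apply: ler_sum_nat => i Hi.
    have Hr := early_anc_range Hh mh Hi.
    rewrite (big_pred1 (Ordinal (Hl _ Hi))); last first.
      by move=> l; rewrite /= -val_eqE /=; lia.
    rewrite /ind ler_nat; case: eqP => // E; rewrite lt0b; apply/eqP/ffunP => k.
    rewrite [RHS]ffunE -E !blocks_cons //.
    have -> : (k == Ordinal (Hl i Hi)) = (early_anc m h i == k.+1).
      by rewrite -val_eqE /=; lia.
    by case: eqP => _; rewrite ?addn1 ?addn0.
  rewrite (exchange_big_dep xpredT) //=; apply: ler_sum => l _.
  rewrite -big_filter big_const_seq iter_addr_0 count_predT size_filter.
  rewrite -[_ *+ _]mulr_natl /ind; case: eqP => [E|_]; last by rewrite !mulr0.
  rewrite !mulr1 ler_nat /index_iota subn1 /=.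
  have := congr1 (fun f : {ffun _} => f l) E.
  by rewrite !ffunE eqxx /= => <-.
rewrite (le_trans (ler_wpM2r _ step)) // mean_sum mulr_suml.
under eq_bigr do rewrite meanZ.
have C0 k : 0 < 'C(m + k, m)%:R :> R by rewrite ltr0n bin_gt0 leq_addr.
have N0 : 0 < (m + j.+1)%:R :> R by rewrite ltr0n; lia.
apply: (@le_trans _ _ (\sum_l (z l).-1%:R / (m + j.+1)%:R / 'C(m + j, m)%:R *
   'C(m + j.+1, m)%:R)).
  apply: ler_sum => l _; rewrite ler_pM2r // ler_wpM2l ?divr_ge0 //.
  by rewrite -[leRHS]mul1r ler_pdivlMr.
rewrite -!mulr_suml -natr_sum.
have -> : (\sum_l (z l).-1 = j.+1)%N.
  have : (\sum_l z l = \sum_l ((z l).-1 + 1))%N.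
    by apply: eq_bigr => l _; rewrite addn1 prednK.
  by rewrite zs big_split /= sum1_card card_ord; lia.
rewrite mulrAC ler_pdivrMr // mul1r mulrAC ler_pdivrMr // -!natrM ler_nat.
have E : (j.+1 * 'C(m + j.+1, m) = (m + j.+1) * 'C(m + j, m))%N.
  by have := mul_bin_down (m + j.+1) m; rewrite addKn addnS.
by rewrite E mulnC.
Qed.

(** Erase the coordinates [p] and [q]: at most (n+1)^(|I| - 2) classes remain. Within a class the
    value at [q] determines the function and lies among D + 1 consecutive integers. *)
Lemma card_fibers (I : finType) n (p q : I) (B : {set {ffun I -> 'I_n.+1}}) D :
  p != q ->
  (forall z z', z \in B -> z' \in B ->
    (forall l, l != p -> l != q -> z l = z' l) ->
    (z q <= z' q + D)%N /\ (z q = z' q -> z = z')) ->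
  (#|B| <= n.+1 ^ (#|I| - 2) * D.+1)%N.
Proof.
move=> pq HB; pose g (z : {ffun I -> 'I_n.+1}) : {ffun I -> 'I_n.+1} :=
  [ffun l => if (l == p) || (l == q) then ord0 else z l].
have gE z z' : g z = g z' -> forall l, l != p -> l != q -> z l = z' l.
  move=> /ffunP E l lp lq; have := E l.
  by rewrite !ffunE (negbTE lp) (negbTE lq).
rewrite -sum1_card (partition_big_imset g) /=.
apply: (@leq_trans (\sum_(y in g @: B) D.+1)%N); last first.
  rewrite sum_nat_const leq_mul2r; apply/orP; right.
  have sB : g @: B \subset pffun_on ord0 (mem ([set~ p] :\ q)) (mem [set: 'I_n.+1]).
    apply/fintype.subsetP => y /imsetP[z _ ->]; apply/pffun_onP; split.
      apply/fintype.subsetP => l; rewrite !inE ffunE.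
      by case: (l == p) => //=; case: (l == q) => //=; rewrite eqxx.
    by move=> l _; rewrite inE.
  apply: leq_trans (subset_leq_card sB) _; rewrite card_pffun_on cardsT card_ord.
  rewrite leq_pexp2l //; have := cardsD1 q [set~ p].
  rewrite cardsC1 in_setC1 eq_sym pq; have /card_gt0P : exists x, x \in I by exists p.
  by rewrite /=; set k := #|_ :\ _|; lia.
apply: leq_sum => _ /imsetP[z0 z0B ->]; rewrite sum1dep_card.
set A := [set _ | _].
have fE z : z \in A -> z \in B /\ forall l, l != p -> l != q -> z l = z0 l.
  by rewrite inE => /andP[zB /eqP /gE].
have fD z z' : z \in A -> z' \in A -> (z q <= z' q + D)%N /\ (z q = z' q -> z = z').
  move=> /fE[zB zE] /fE[z'B z'E]; apply: HB => // l lp lq.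
  by rewrite zE // z'E.
(* The window of D + 1 values starts at the least value at [q] within the class. *)
case: (@arg_minnP _ z0 (mem A) (fun z => z q : nat)) => [|a aA amin].
  by rewrite /= inE z0B eqxx.
rewrite cardE -(size_map (fun z : {ffun I -> 'I_n.+1} => z q : nat)).
rewrite -[leqRHS](size_iota (a q)); apply: uniq_leq_size.
  rewrite map_inj_in_uniq ?enum_uniq // => z z'; rewrite !mem_enum => zA z'A E.
  by apply: (fD _ _ zA z'A).2; apply: val_inj.
move=> _ /mapP[z + ->]; rewrite mem_enum mem_iota => zA.
by rewrite (amin z zA) addnS ltnS (fD _ _ zA aA).1.
Qed.

(** Counts the block vectors compatible with [Phi] by [card_fibers] and bounds the weight of each by
    [mean_blocks_le]. *)
Lemma mean_fibers_le h0 j (Phi : pred (seq nat)) (p q : 'I_(size h0).+1) D :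
  valid h0 -> p != q ->
  (forall t t', size t = j -> size t' = j -> valid (t ++ h0) ->
    valid (t' ++ h0) -> Phi (t ++ h0) -> Phi (t' ++ h0) ->
    (forall l, l != p -> l != q ->
       blocks (size h0) (t ++ h0) l = blocks (size h0) (t' ++ h0) l) ->
    (blocks (size h0) (t ++ h0) q <= blocks (size h0) (t' ++ h0) q + D)%N) ->
  mean j (ind R Phi) h0 * 'C(size h0 + j, size h0)%:R <=
    ((size h0 + j).+2 ^ ((size h0).+1 - 2) * D.+1)%:R.
Proof.
move=> Hh0 pq HP; set m := size h0 in p q pq HP *.
pose zv (z : {ffun 'I_m.+1 -> 'I_(m + j).+2}) : {ffun 'I_m.+1 -> nat} :=
  [ffun l => z l : nat].
pose B := [set z | `[< exists t, [/\ size t = j, valid (t ++ h0),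
  Phi (t ++ h0) & blocks m (t ++ h0) = zv z] >]].
have mt t : (m <= size (t ++ h0))%N by rewrite size_cat leq_addl.
have cB : (#|B| <= (m + j).+2 ^ (m.+1 - 2) * D.+1)%N.
  rewrite -[X in (X - 2)%N](card_ord m.+1).
  apply: (card_fibers pq) => z z'.
  rewrite !inE => -[t [st Ht Pt Et]] [t' [st' Ht' Pt' Et']] E.
  have Ez l : z l = blocks m (t ++ h0) l :> nat by rewrite Et ffunE.
  have Ez' l : z' l = blocks m (t' ++ h0) l :> nat by rewrite Et' ffunE.
  have EE l : l != p -> l != q -> blocks m (t ++ h0) l = blocks m (t' ++ h0) l.
    by move=> lp lq; rewrite -Ez -Ez' E.
  split; first by rewrite Ez Ez'; apply: HP.
  move=> Eq; apply/ffunP => l; apply: val_inj => /=.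
  have [->|lq] := eqVneq l q; first by rewrite Eq.
  have [->|lp] := eqVneq l p; last by rewrite E.
  (* Both vectors have the same total, so the one remaining entry, at [p], is forced. *)
  have := sum_blocksT Ht (mt t); have := sum_blocksT Ht' (mt t').
  rewrite !size_cat st st' => <-; rewrite (bigD1 p) //= [RHS](bigD1 p) //= -Ez -Ez'.
  rewrite (bigD1 q) 1?eq_sym //= [in RHS](bigD1 q) 1?eq_sym //= -Ez -Ez' Eq.
  under eq_bigr => k /andP[kp kq] do rewrite EE //.
  lia.
have C0 : 0 < 'C(m + j, m)%:R :> R by rewrite ltr0n bin_gt0 leq_addr.
apply: le_trans (_ : #|B|%:R <= _); last by rewrite ler_nat.
rewrite -ler_pdivlMr //.
apply: (@le_trans _ _ (mean j
  (fun h => \sum_(z in B) ind R (fun h => blocks m h == zv z) h) h0)).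
  apply: mean_le => // t st Ht; rewrite /ind.
  case: (boolP (Phi _)) => [Pt|_]; last by rewrite sumr_ge0.
  have bl l : (blocks m (t ++ h0) l < (m + j).+2)%N.
    have := sum_blocksT Ht (mt t); rewrite (bigD1 l) //= size_cat st /m; lia.
  pose z : {ffun 'I_m.+1 -> 'I_(m + j).+2} := [ffun l => Ordinal (bl l)].
  have zE : blocks m (t ++ h0) = zv z by apply/ffunP => l; rewrite [RHS]ffunE [in RHS]ffunE.
  have zB : z \in B by rewrite !inE; exists t; split.
  by rewrite (bigD1 z) //= zE eqxx lerDl sumr_ge0.
rewrite mean_sum -sum1_card natr_sum mulr_suml; apply: ler_sum => z _.
by rewrite ler_pdivlMr //; apply: mean_blocks_le.
Qed.

End Uniform.

Definition fiber_cst (m : nat) : nat := ((2 * m.+1) ^ m * m`!)%N.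

(** The falling factorial m! C(n, m) is at least ((n+1) / (m+1))^m for n >= m; the power of 2 pays
    for passing from n + 2 to n + 1. *)
Lemma fiber_cst_bound m j : (0 < m)%N ->
  ((m + j).+1 * (m + j).+2 ^ (m.+1 - 2) <= fiber_cst m * 'C(m + j, m))%N.
Proof.
move=> m0; set n := (m + j)%N.
have H k : (k <= m)%N -> (n.+1 ^ k <= m.+1 ^ k * n ^_ k)%N.
  elim: k => [//|k IH] km; rewrite expnSr ffactnSr expnSr mulnACA.
  apply: leq_mul; [exact/IH/ltnW | rewrite /n; nia].
have {H} := H m (leqnn m); rewrite -bin_ffact /fiber_cst expnMn => H.
apply: (@leq_trans (2 ^ m * n.+1 ^ m)%N); last first.
  by rewrite -!mulnA leq_mul2l; apply/orP; right; rewrite [(m`! * _)%N]mulnC.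
have -> : (m.+1 - 2 = m.-1)%N by lia.
rewrite -expnMn -(prednK m0) expnS prednK //.
apply: leq_mul; first by lia.
by case: (posnP m.-1) => [->//|k0]; rewrite leq_exp2r //; lia.
Qed.

Section AntiConcentration.
Variable R : realFieldType.
Implicit Types h t : seq nat.

(** Anticoncentration of S(v) for the newest vertex v of [h0]: an event that confines S(v) to D + 1
    values once the S(u) of its proper ancestors are known has probability of order (D+1) / N. The
    two free coordinates are the blocks of v and of its parent. *)
Lemma mean_anc_fibers_le h0 j (Phi : pred (seq nat)) D : valid h0 ->
  (0 < size h0)%N ->
  (forall t t', size t = j -> size t' = j -> valid (t ++ h0) ->
    valid (t' ++ h0) -> Phi (t ++ h0) -> Phi (t' ++ h0) ->
    (forall u, u \in anc h0 (par h0 (size h0).+1) ->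
       sub_size (t ++ h0) u = sub_size (t' ++ h0) u) ->
    (sub_size (t ++ h0) (size h0).+1 <=
       sub_size (t' ++ h0) (size h0).+1 + D)%N) ->
  mean j (ind R Phi) h0 * (size h0 + j).+1%:R <=
    (fiber_cst (size h0) * D.+1)%:R.
Proof.
move=> Hh0 m0 HP; set m := size h0 in m0 HP *; set p := par h0 m.+1 in HP.
have Hp : (0 < p < m.+1)%N by apply: par_range => //; lia.
have Hp' : (p.-1 < m.+1)%N by lia.
have pq : Ordinal Hp' != ord_max :> 'I_m.+1 by rewrite -val_eqE /=; lia.
have mt t : (m <= size (t ++ h0))%N by rewrite size_cat leq_addl.
(* Vertex m+1 is the newest early vertex, so its block is its whole subtree. *)
have Sv t : valid (t ++ h0) -> sub_size (t ++ h0) m.+1 = blocks m (t ++ h0) ord_max.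
  move=> Ht; rewrite sub_size_blocks // (big_pred1 ord_max) // => l /=.
  rewrite -val_eqE /=; apply/idP/eqP => [/(desc_ge Hh0)|->]; last first.
    by apply: descxx => //; lia.
  by rewrite -/m; have := ltn_ord l; lia.
have B0 : 0 <= mean j (ind R Phi) h0.
  rewrite -(mean_cst j 0 h0); apply: mean_le => // *; exact: ler0n.
have C0 : (0 < 'C(m + j, m))%N by rewrite bin_gt0 leq_addr.
rewrite -(@ler_pM2r _ 'C(m + j, m)%:R) ?ltr0n // mulrAC.
apply: (@le_trans _ _ (((m + j).+2 ^ (m.+1 - 2) * D.+1)%:R * (m + j).+1%:R)).
  rewrite ler_pM2r ?ltr0n //; apply: (mean_fibers_le _ Hh0 pq) => t t' st st' Ht Ht' Pt Pt' E.
  rewrite -!Sv //; apply: HP => // u Hu.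
  have Hu' : u \in anc h0 m.+1 by rewrite anc_par ?inE ?Hu ?orbT //; lia.
  have ur := anc_sub Hh0 (_ : 0 < m.+1 <= (size h0).+1)%N Hu'.
  rewrite !sub_size_blocks //; try lia.
  have := sum_blocksT Ht (mt t); have := sum_blocksT Ht' (mt t').
  rewrite !size_cat st st' => <-; rewrite (bigID (fun l : 'I_m.+1 => desc h0 u l.+1)) /=.
  rewrite [RHS](bigID (fun l : 'I_m.+1 => desc h0 u l.+1)) /= -/m.
  set a := (\sum_(_ < _ | ~~ _) _)%N; set b := (\sum_(_ < _ | ~~ _) _)%N.
  (* The complement of the subtree of [u] contains neither v nor its parent, so the blocks in it
     agree, and with N fixed so does S(u). *)
  suff -> : a = b by lia.
  apply: eq_bigr => l nd; apply: E; apply: contra nd => /eqP ->.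
    rewrite /= prednK; last by lia.
    by apply: (desc_anc Hh0 _ Hu); [lia | apply: descxx => //; lia].
  by apply: (desc_anc Hh0 _ Hu'); [lia | apply: descxx => //; lia].
rewrite -!natrM ler_nat; have := fiber_cst_bound j m0; rewrite -/m; nia.
Qed.

Definition gap h v : R :=
  \prod_(u <- anc h v) share R h u - \prod_(u <- anc h v) (1 - share R h u).

Lemma beats_rootE h v : valid h -> beats_root h v = (0 <= gap h v).
Proof.
move=> Hh; rewrite /beats_root /gap subr_ge0 -(ler_nat R).
have fE u : share R h u = (sub_size h u)%:R / (size h).+1%:R by [].
have gE u : 1 - share R h u = ((size h).+1 - sub_size h u)%:R / (size h).+1%:R.
  rewrite natrB ?sub_size_le // fE mulrBl divff // gt_eqF ?nv_gt0 //.
rewrite (eq_bigr _ (fun u _ => gE u)) [X in _ = (_ <= X)](eq_bigr _ (fun u _ => fE u)).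
rewrite !prodf_div ler_pM2r ?natr_prod // invr_gt0.
by rewrite prodr_gt0 // => u _; rewrite ltr0n.
Qed.

Lemma dist_prod_le (l : seq nat) (f g : nat -> R) (e : R) :
  (forall u, u \in l -> 0 <= f u <= 1) -> (forall u, u \in l -> 0 <= g u <= 1) ->
  (forall u, u \in l -> `|f u - g u| <= e) ->
  `|\prod_(u <- l) f u - \prod_(u <- l) g u| <= (size l)%:R * e.
Proof.
elim: l => [|x l IH] Hf Hg He; first by rewrite !big_nil subrr normr0 mul0r.
rewrite !big_cons /=; set a := \prod_(_ <- _) _; set b := \prod_(_ <- _) _.
have -> : f x * a - g x * b = f x * (a - b) + (f x - g x) * b by ring.
have Hl (Q : nat -> Prop) : (forall u, u \in x :: l -> Q u) -> forall u, u \in l -> Q u.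
  by move=> H u ul; apply: H; rewrite inE ul orbT.
have /andP[b0 b1] : 0 <= b <= 1.
  rewrite /b big_seq; elim/big_ind: _ => [|y z /andP[y0 y1] /andP[z0 z1]|u ul].
  - by rewrite ler01 lexx.
  - by rewrite mulr_ge0 // mulr_ile1.
  - exact: Hl _ Hg u ul.
have /andP[f0 f1] := Hf x (mem_head x l).
have e0 := He x (mem_head x l).
have := IH (Hl _ Hf) (Hl _ Hg) (Hl _ He); rewrite -/a -/b => ab.
apply: le_trans (ler_normD _ _) _; rewrite !normrM (ger0_norm f0) (ger0_norm b0).
rewrite -natr1 mulrDl mul1r; apply: lerD.
  by apply: le_trans ab; rewrite ler_piMl.
by apply: le_trans e0; rewrite ler_piMr.
Qed.

(** In terms of y = y(v): y <= 1/K, or 1 - y <= 1/K, or |G(v)| < K^-v. *)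
Definition unsettled (v K : nat) h : bool :=
  [|| (sub_size h v * K <= (size h).+1)%N,
      (((size h).+1 - sub_size h v) * K <= (size h).+1)%N |
      `|gap h v| < K%:R ^- v].

(** With the other shares on the path fixed, G(v) = y(v)(P + Q) - Q is affine in y(v), of slope at
    least K^-(v-1). Two values of G(v) within K^-v of 0 therefore have y(v) within 2/K of each
    other. *)
Lemma small_gap_close t t' h0 K : let v := (size h0).+1 in
  let N := (size (t ++ h0)).+1 in
  valid (t ++ h0) -> valid (t' ++ h0) -> size (t ++ h0) = size (t' ++ h0) ->
  (0 < size h0)%N -> (1 < K)%N ->
  (N < sub_size (t' ++ h0) v * K)%N ->
  `|gap (t ++ h0) v| < K%:R ^- v -> `|gap (t' ++ h0) v| < K%:R ^- v ->
  (forall u, u \in anc h0 (par h0 v) ->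
     sub_size (t ++ h0) u = sub_size (t' ++ h0) u) ->
  (sub_size (t ++ h0) v <= sub_size (t' ++ h0) v + 2 * N %/ K)%N.
Proof.
move=> v N Ht Ht' sN m0 K1 S1.
have K0 : 0 < K%:R :> R by rewrite ltr0n (ltn_trans _ K1).
have N0 : 0 < N%:R :> R by rewrite ltr0n.
have Hh0 := valid_cat Ht.
have v1 : (1 < v <= (size h0).+1)%N by rewrite ltnS m0 leqnn.
have v0 : (0 < v <= (size h0).+1)%N by rewrite leqnn.
have Hp := par_range Hh0 v1; set p := par h0 v in Hp *.
have aE s : anc (s ++ h0) v = v :: anc h0 p by rewrite anc_cat // anc_par.
(* Each proper ancestor is at least as heavy as v, hence has share at least 1/K, and there are at
   most v - 1 of them. *)
have P0 : K%:R ^- (size h0) <= \prod_(u <- anc h0 p) share R (t' ++ h0) u.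
  have sa : (size (anc h0 p) < p)%N by apply: size_anc => //; case/andP: Hp => -> /ltnW.
  apply: (@le_trans _ _ (K%:R ^- size (anc h0 p))).
    rewrite lef_pV2 ?posrE ?exprn_gt0 // ler_eXn2l ?ltr1n //.
    by rewrite -ltnS (leq_trans sa) // ltnW; case/andP: Hp.
  have -> : K%:R ^- size (anc h0 p) = \prod_(u <- anc h0 p) K%:R^-1 :> R.
    by rewrite big_const_seq count_predT iter_mulr_1 exprVn.
  rewrite big_seq [leRHS]big_seq; apply: ler_prod => u up.
  rewrite invr_ge0 ler0n /= /share -sN ler_pdivlMr // mulrC ler_pdivrMr //.
  rewrite -natrM ler_nat; apply: leq_trans (ltnW S1) _.
  rewrite leq_mul2r; apply/orP; right.
  apply: sub_size_anc; [by []| |by rewrite aE inE up orbT].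
  by rewrite size_cat /v !ltnS leq_addl.
move=> G1 G1' E.
have fE u : u \in anc h0 p -> share R (t ++ h0) u = share R (t' ++ h0) u.
  by move=> up; rewrite /share E // sN.
move: G1 G1'; rewrite /gap !aE !big_cons (eq_big_seq _ fE).
have -> : \prod_(u <- anc h0 p) (1 - share R (t ++ h0) u) =
  \prod_(u <- anc h0 p) (1 - share R (t' ++ h0) u).
  by apply: eq_big_seq => u up; rewrite fE.
move: P0; set P := \prod_(_ <- _) share _ _ _.
set Q := \prod_(_ <- _) _ => P0.
have Q0 : 0 <= Q by rewrite prodr_ge0 // => u _; rewrite subr_ge0 share_le1.
move=> G1 G1'; rewrite leqNgt; apply/negP => Hlt.
have DN : (2 * N < (sub_size (t ++ h0) v - sub_size (t' ++ h0) v) * K)%N.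
  apply: leq_trans (ltn_ceil (2 * N) (ltnW K1)) _.
  by rewrite leq_mul2r ltn_subRL Hlt orbT.
have dy : 2 < (share R (t ++ h0) v - share R (t' ++ h0) v) * K%:R.
  rewrite /share -sN -mulrBl mulrAC ltr_pdivlMr // -natrB.
    by rewrite -!natrM ltr_nat.
  by apply: leq_trans (ltnW Hlt); rewrite leq_addr.
have KV : K%:R ^- v * K%:R = K%:R ^- (size h0) :> R.
  by rewrite /v exprSr invfM mulfVK // gt_eqF.
move: G1 G1' dy; move: (share R (t ++ h0) v) (share R (t' ++ h0) v) => y y'.
rewrite !ltr_norml => /andP[_ G1] /andP[G1' _] dy.
have : (y - y') * (P + Q) < 2 * K%:R ^- v.
  by clear -G1 G1'; lra.
apply/negP; rewrite -leNgt -(ler_pM2r K0) -mulrA KV mulrAC.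
have y0 : 2 <= (y - y') * K%:R by apply: ltW.
have k0 : 0 <= K%:R ^- (size h0) :> R by rewrite invr_ge0 exprn_ge0.
by apply: ler_pM => //; rewrite -[leLHS]addr0 lerD.
Qed.

(** The three clauses of [unsettled] confine S(v) to windows of about N/K, N/K and 2N/K values:
    hence 4/K, and 3/N from rounding. *)
Lemma mean_unsettled_le h0 j K : valid h0 -> (0 < size h0)%N -> (1 < K)%N ->
  mean j (ind R (unsettled (size h0).+1 K)) h0 <=
    (fiber_cst (size h0))%:R * (4 / K%:R + 3 / (size h0 + j).+1%:R).
Proof.
move=> Hh0 m0 K1; set m := size h0 in m0 *; set v := m.+1; set N := (m + j).+1.
have N0 : 0 < N%:R :> R by rewrite ltr0n.
have K0 : 0 < K%:R :> R by rewrite ltr0n; lia.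
have sN t : size t = j -> (size (t ++ h0)).+1 = N.
  by move=> st; rewrite size_cat st addnC.
have Sle t u : size t = j -> (sub_size (t ++ h0) u <= N)%N.
  by move=> st; rewrite -(sN t st) sub_size_le.
have D1 a b : (a * K <= N)%N -> (a <= b + N %/ K)%N.
  move=> H; rewrite -leq_subLR leq_divRL; last by apply: ltnW.
  by apply: leq_trans H; rewrite leq_mul2r leq_subr orbT.
pose low h := (sub_size h v * K <= (size h).+1)%N.
pose high h := (((size h).+1 - sub_size h v) * K <= (size h).+1)%N.
(* Excluding [low] keeps y(v) above 1/K, as [small_gap_close] requires. *)
pose near h := ~~ low h && (`|gap h v| < K%:R ^- v).
have B1 : mean j (ind R low) h0 * N%:R <= (fiber_cst m * (N %/ K).+1)%:R.
  apply: mean_anc_fibers_le => // t t' st st' Ht Ht'; rewrite /low sN // => + _ _.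
  exact: D1.
have B2 : mean j (ind R high) h0 * N%:R <= (fiber_cst m * (N %/ K).+1)%:R.
  apply: mean_anc_fibers_le => // t t' st st' Ht Ht'; rewrite /high !sN // => _ H _.
  rewrite -/m -/v; have := D1 _ 0%N H; have := Sle t v st; lia.
have B3 : mean j (ind R near) h0 * N%:R <= (fiber_cst m * (2 * N %/ K).+1)%:R.
  apply: mean_anc_fibers_le => // t t' st st' Ht Ht'; rewrite /near /low !sN //.
  rewrite -!ltnNge => /andP[S1 G1] /andP[S1' G1'] E.
  have sE : size (t ++ h0) = size (t' ++ h0) by rewrite !size_cat st st'.
  have := small_gap_close Ht Ht' sE m0 K1; rewrite sN //; exact.
have : mean j (ind R (unsettled v K)) h0 * N%:R <=
    (fiber_cst m * (N %/ K).+1)%:R + (fiber_cst m * (N %/ K).+1)%:R +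
    (fiber_cst m * (2 * N %/ K).+1)%:R.
  apply: le_trans (lerD (lerD B1 B2) B3); rewrite -!mulrDl ler_pM2r //.
  rewrite -!meanD; apply: mean_le => // t st Ht.
  rewrite /ind /unsettled /near /high /low -!natrD ler_nat.
  by case: (sub_size _ _ * _ <= _)%N; case: ((_ - _) * _ <= _)%N;
    case: (`|gap _ _| < _).
rewrite -ler_pdivlMr // => /le_trans; apply.
have dK a : (a %/ K)%:R <= a%:R / K%:R :> R.
  by rewrite ler_pdivlMr // -natrM ler_nat leq_trunc_div.
rewrite ler_pdivrMr // -mulrA mulrDl divfK ?gt_eqF // !natrM -!mulrDr.
rewrite ler_wpM2l // -![(_ %/ _).+1%:R]natr1; have := dK N; have := dK (2 * N)%N.
by rewrite natrM [4 / _ * _]mulrAC; lra.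
Qed.

End AntiConcentration.

(** * When the comparison of one vertex with the root is decided for good *)

Section Settling.
Variable R : realType.
Implicit Types h t : seq nat.

(* If each y(u) moves by less than tol, then G(v), built from two products of
   fewer than v factors, moves by less than K^-v. *)
Definition tol (v K : nat) : R := K%:R ^- v / (4 * v%:R).

Lemma tol_gt0 v K : (0 < v)%N -> (1 < K)%N -> 0 < tol v K.
Proof.
move=> v0 K1; rewrite divr_gt0 ?mulr_gt0 ?ltr0n //.
by rewrite invr_gt0 exprn_gt0 // ltr0n; lia.
Qed.

(** Initially |G(v)| >= K^-v, and small drifts on the path move G(v) by less than that, so its sign
    persists; likewise 1 - y(v), initially above 1/K, stays above 1/(2K). *)
Lemma settled_stable v K t h : (1 < v <= (size h).+1)%N -> (1 < K)%N ->
  valid (t ++ h) -> ~~ unsettled R v K h ->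
  ~~ drifted (anc h v) (tol v K) h (t ++ h) ->
  beats_root (t ++ h) v = beats_root h v /\
  ((size (t ++ h)).+1 <=
     2 * K * ((size (t ++ h)).+1 - sub_size (t ++ h) v))%N.
Proof.
move=> Hv K1 Ht; have Hh := valid_cat Ht.
have K0 : 0 < K%:R :> R by rewrite ltr0n; lia.
have v0 : (0 < v <= (size h).+1)%N by lia.
rewrite /unsettled !negb_or -!ltnNge -leNgt => /and3P[S1 S2 G].
move/hasPn => nd.
have close u : u \in anc h v -> `|share R (t ++ h) u - share R h u| <= tol v K.
  by move/nd; rewrite -ltNge => /ltW.
have Kv : K%:R ^- v <= K%:R^-1 :> R.
  rewrite lef_pV2 ?posrE ?exprn_gt0 // -[leLHS]expr1 ler_eXn2l ?ltr1n //; lia.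
have kv0 : 0 < K%:R ^- v :> R by rewrite invr_gt0 exprn_gt0.
have vR : 2 <= v%:R :> R by rewrite ler_nat; lia.
have tolE : tol v K * (4 * v%:R) = K%:R ^- v by rewrite divfK //; lra.
have t0 : 0 < tol v K by apply: tol_gt0 => //; lia.
have sa : (size (anc h v) < v)%N by apply: size_anc.
have saR : (size (anc h v))%:R <= v%:R :> R by rewrite ler_nat ltnW.
have sh s u : 0 <= share R s u <= 1 by rewrite share_ge0 share_le1.
have sh' s u : 0 <= 1 - share R s u <= 1.
  by have /andP[a b] := sh s u; apply/andP; split; lra.
have dg : `|gap R (t ++ h) v - gap R h v| < K%:R ^- v.
  rewrite /gap anc_cat //.
  have := @dist_prod_le R (anc h v) _ _ (tol v K)
    (fun u _ => sh (t ++ h) u) (fun u _ => sh h u) close.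
  have cl' u : u \in anc h v ->
      `|(1 - share R (t ++ h) u) - (1 - share R h u)| <= tol v K.
    move/close; rewrite distrC.
    by have -> : share R h u - share R (t ++ h) u =
      1 - share R (t ++ h) u - (1 - share R h u) by ring.
  have := @dist_prod_le R (anc h v) _ _ (tol v K)
    (fun u _ => sh' (t ++ h) u) (fun u _ => sh' h u) cl'.
  set a := \prod_(_ <- _) _; set b := \prod_(_ <- _) _.
  set a' := \prod_(_ <- _) _; set b' := \prod_(_ <- _) _ => H1 H2.
  have -> : a' - a - (b' - b) = (a' - b') - (a - b) by ring.
  apply: le_lt_trans (ler_normB _ _) _.
  have := ler_wpM2r (ltW t0) saR; nra.
split.
  rewrite !(beats_rootE R) //; move: G dg.
  move: (gap R h v) (gap R (t ++ h) v) => g g'.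
  rewrite ltr_norml => G /andP[d1 d2].
  move: G; have [g0|g0] := leP 0 g.
    by rewrite ger0_norm // => G; apply/idP; lra.
  by rewrite ltr0_norm // => G; apply/negbTE; rewrite -ltNge; lra.
have := close v (_ : v \in anc h v); rewrite anc_par // mem_head => /(_ isT).
rewrite ler_norml => /andP[_ d].
have y1 : share R h v <= 1 - K%:R^-1.
  rewrite lerBrDr -lerBrDl /share.
  have -> : 1 - (sub_size h v)%:R / (size h).+1%:R =
     ((size h).+1 - sub_size h v)%:R / (size h).+1%:R :> R.
    by rewrite natrB ?sub_size_le // mulrBl divff // gt_eqF ?nv_gt0.
  rewrite ler_pdivlMr ?nv_gt0 // mulrC ler_pdivrMr // -natrM ler_nat ltnW //.
have kK : K%:R^-1 * K%:R = 1 :> R by rewrite mulVf // gt_eqF.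
(* As v >= 2, [tol v K] is at most K^-v / 8, so half of the margin 1/K survives. *)
have : share R (t ++ h) v <= 1 - K%:R^-1 / 2 by nra.
rewrite /share ler_pdivrMr ?nv_gt0 //.
rewrite -(ler_nat R) natrM natrB ?sub_size_le // natrM.
have := ler0n R (size (t ++ h)).+1.
move: (size _).+1%:R (sub_size _ _)%:R => N S N0 H.
have : S * (2 * K%:R) <= (1 - K%:R^-1 / 2) * N * (2 * K%:R).
  by rewrite ler_wpM2r // mulr_ge0 // ltW.
have -> : (1 - K%:R^-1 / 2) * N * (2 * K%:R) = N * (2 * K%:R) - N * (K%:R^-1 * K%:R).
  by field; rewrite gt_eqF.
rewrite kK; lra.
Qed.

(** The drift is measured from the state of the same history at time [n0]. *)
Definition drift_event (v K n0 : nat) h : bool :=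
  drifted (anc h v) (tol v K) (drop (size h - n0) h) h.

Lemma settling v (eta : R) : (1 < v)%N -> 0 < eta ->
  exists K n0, [/\ (1 < K)%N, (v <= n0.+1)%N,
    mean n0 (ind R (unsettled R v K)) [::] <= eta &
    forall n, (n0 <= n)%N ->
      mean n (ind R (ever n0 (drift_event v K n0))) [::] <= eta].
Proof.
move=> v1 eta0; set C : R := (fiber_cst v.-1)%:R.
have C0 : 0 <= C by rewrite ler0n.
(* Makes 4C/K at most eta/2. [K] is fixed before [n0], since the tolerated drift depends on it. *)
pose K := (Num.bound (8 * C / eta)).+2.
have K1 : (1 < K)%N by [].
have K0 : 0 < K%:R :> R by rewrite ltr0n.
have KC : C * (4 / K%:R) <= eta / 2.
  rewrite mulrA ler_pdivrMr //.
  have aP : 0 <= 8 * C / eta by rewrite divr_ge0 ?mulr_ge0 // ltW.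
  have := archi_boundP aP; rewrite ltr_pdivrMr // => H.
  have : (Num.bound (8 * C / eta))%:R <= K%:R :> R by rewrite ler_nat; lia.
  nra.
have t0 : 0 < tol v K by apply: tol_gt0 => //; lia.
(* [n0 + 1 >= a] makes 3C/(n0+1) at most eta/2; [n0 + 1 >= b] makes the bound of [mean_drifted] at
   most eta. *)
pose a : R := 6 * C / eta; pose b : R := v%:R / (tol v K ^+ 2 * eta).
have a0 : 0 <= a by rewrite divr_ge0 ?mulr_ge0 // ltW.
have b0 : 0 <= b by rewrite divr_ge0 // mulr_ge0 ?exprn_ge0 // ltW.
pose n0 := (Num.bound a + Num.bound b + v)%N.
have na : a <= n0.+1%:R.
  by apply: le_trans (ltW (archi_boundP a0)) _; rewrite ler_nat /n0; lia.
have nb : b <= n0.+1%:R.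
  by apply: le_trans (ltW (archi_boundP b0)) _; rewrite ler_nat /n0; lia.
exists K, n0; split => //; first by rewrite /n0; lia.
  (* Condition on the history of length v - 1, in which [v] is the newest vertex. *)
  have -> : n0 = (v.-1 + (n0 - v.-1))%N by rewrite /n0; lia.
  rewrite mean_add -[leRHS](mean_cst v.-1 eta [::]); apply: mean_le => // h sh.
  rewrite cats0 => Hh; have Hs : (size h).+1 = v by rewrite sh prednK //; lia.
  have := @mean_unsettled_le R h (n0 - v.-1) K Hh.
  rewrite Hs sh => /(_ _ K1) H; apply: le_trans (H _) _; first by lia.
  rewrite -/C (_ : (v.-1 + (n0 - v.-1)).+1 = n0.+1); last by rewrite /n0; lia.
  rewrite mulrDr [eta]splitr lerD // mulrA ler_pdivrMr ?nv_gt0 ?ltr0n //.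
  by move: na; rewrite /a ler_pdivrMr //; nra.
move=> n nn; have -> : n = (n0 + (n - n0))%N by lia.
rewrite mean_add -[leRHS](mean_cst n0 eta [::]); apply: mean_le => // h sh.
rewrite cats0 => Hh.
have vh : (0 < v <= (size h).+1)%N by rewrite sh /n0; lia.
(* Given the history [h] at time [n0], the reference state is the constant [h], as [mean_drifted]
   needs. *)
have evE t : ever n0 (drift_event v K n0) (t ++ h) =
    ever (size h) (drifted (anc h v) (tol v K) h) (t ++ h).
  rewrite /ever sh; congr andb; rewrite size_cat sh addnK.
  apply: eq_in_has => k; rewrite mem_iota add0n ltnS /= => kt.
  have -> : drop k (t ++ h) = drop k t ++ h.
    by rewrite drop_cat; case: ltngtP kt => // ->; rewrite subnn drop0 drop_size.
  by rewrite /drift_event size_cat sh addnK drop_size_cat // anc_cat.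
apply: (@le_trans _ _ (mean (n - n0)
  (ind R (ever (size h) (drifted (anc h v) (tol v K) h))) h)).
  by apply: mean_le => // t _ _; rewrite /ind evE.
have Hl u : u \in anc h v -> (u <= (size h).+1)%N.
  by move/anc_sub => /(_ Hh); rewrite sh /n0; lia.
apply: le_trans (mean_drifted _ t0 Hh Hl) _.
have sa : (size (anc h v))%:R <= v%:R :> R.
  by rewrite ler_nat ltnW // size_anc // sh /n0; lia.
have t2 : 0 < tol v K ^+ 2 by rewrite exprn_gt0.
have t2e : 0 < tol v K ^+ 2 * eta by rewrite mulr_gt0.
rewrite sh ler_pdivrMr // ler_pdivrMr ?ltr0n //.
apply: le_trans sa _; move: nb; rewrite /b ler_pdivrMr //.
by move/le_trans; apply; rewrite mulrC [eta * _]mulrC.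
Qed.

End Settling.

(** * Almost sure behaviour *)

Local Open Scope classical_set_scope.

Fixpoint hist (W : Type) (c : nat -> W -> nat) (n : nat) (w : W) : seq nat :=
  if n is k.+1 then c k.+1 w :: hist c k w else [::].

Lemma size_hist (W : Type) (c : nat -> W -> nat) n w : size (hist c n w) = n.
Proof. by elim: n => //= n ->. Qed.

Lemma drop_hist (W : Type) (c : nat -> W -> nat) m n w : (m <= n)%N ->
  drop (n - m) (hist c n w) = hist c m w.
Proof.
elim: n => [|n IH]; first by rewrite leqn0 => /eqP ->.
rewrite leq_eqVlt => /orP[/eqP->|mn]; first by rewrite subnn drop0.
by rewrite subSn //= IH.
Qed.

(** * The law of the random history *)

Section RandomTree.
Context (d : measure_display) (Omega : measurableType d) (R : realType).
Variables (P : probability Omega R) (c : nat -> {RV P >-> nat}).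
Hypothesis c_range : forall n w, (0 < n)%N -> (1 <= c n w <= n)%N.
Hypothesis c_unif : forall n i, (1 <= i <= n)%N ->
  P [set w | c n w = i] = (n%:R^-1)%:E.
Hypothesis c_indep : forall n (i : nat) A, (0 < n)%N -> past c n A ->
  P ([set w | c n w = i] `&` A) = (P [set w | c n w = i] * P A)%E.

Let hist n w := hist (fun k => c k : Omega -> nat) n w.

Lemma valid_hist n w : valid (hist n w).
Proof. by elim: n => //= n ->; rewrite size_hist andbT; apply: c_range. Qed.

Lemma past_hist n k h : (k <= n)%N -> past c n.+1 [set w | hist k w = h].
Proof.
pose G := \bigcup_(m in [set m | (1 <= m < n.+1)%N])
        preimage_set_system setT (c m) measurable.
change ((k <= n)%N -> @measurable _ (g_sigma_algebraType G) [set w | hist k w = h]).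
elim: k h => [|k IH] h kn.
  case: h => [|i h]; first by rewrite (_ : [set _ | _] = setT) //; apply/seteqP; split.
  by rewrite (_ : [set _ | _] = set0) //; apply/seteqP; split.
case: h => [|i h].
  by rewrite (_ : [set _ | _] = set0) //; apply/seteqP; split.
rewrite (_ : [set _ | _] = c k.+1 @^-1` [set i] `&` [set w | hist k w = h]); last first.
  by apply/seteqP; split => w /= -[E1 E2]; [split | congr (_ :: _)].
apply: measurableI; last by apply: IH; exact: ltnW.
apply: sub_gen_smallest; exists k.+1 => //=.
by exists [set i] => //; rewrite setTI.
Qed.

Lemma measurable_c n (i : nat) : measurable [set w | c n w = i].
Proof.
have := @measurable_funPT _ _ _ _ (c n) measurableT [set i].
by rewrite setTI; apply.
Qed.

Lemma measurable_hist_eq n h : measurable [set w | hist n w = h].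
Proof.
elim: n h => [|n IH] h.
  case: h => [|i h]; first by rewrite (_ : [set _ | _] = setT) //; apply/seteqP; split.
  by rewrite (_ : [set _ | _] = set0) //; apply/seteqP; split.
case: h => [|i h].
  by rewrite (_ : [set _ | _] = set0) //; apply/seteqP; split.
rewrite (_ : [set _ | _] = [set w | c n.+1 w = i] `&` [set w | hist n w = h]); last first.
  by apply/seteqP; split => w /= -[E1 E2]; [split | congr (_ :: _)].
by apply: measurableI => //; apply: measurable_c.
Qed.

(** Histories range over a countable set, so every property of them is an event. *)
Lemma measurable_hist n (Q : set (seq nat)) : measurable [set w | Q (hist n w)].
Proof.
rewrite (_ : [set _ | _] = \bigcup_h (if `[< Q h >] then [set w | hist n w = h] else set0)).
  apply: countable_bigcupT_measurable => [|h]; first exact: countableP.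
  by case: ifP => _ //; apply: measurable_hist_eq.
apply/seteqP; split => [w Qw|w [h _]]; first by exists (hist n w) => //; case: asboolP.
by case: asboolP => // Qh /= ->.
Qed.

Lemma prob_hist_cons n h i : (0 < i <= n.+1)%N ->
  P [set w | hist n.+1 w = i :: h] = ((n.+1%:R^-1)%:E * P [set w | hist n w = h])%E.
Proof.
move=> Hi.
rewrite (_ : [set _ | _] = [set w | c n.+1 w = i] `&` [set w | hist n w = h]); last first.
  by apply/seteqP; split => w /= -[E1 E2]; [split | congr (_ :: _)].
by rewrite c_indep // ?c_unif //; apply: past_hist.
Qed.

(** Identifies [mean] with conditional probability: the next choice is uniform and independent of
    the past, which matches one unfolding of [mean]. *)
Lemma prob_hist_ext n j h (Phi : pred (seq nat)) : size h = n ->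
  P [set w | hist n w = h /\ Phi (hist (n + j) w)] =
  (P [set w | hist n w = h] * (mean j (ind R Phi) h)%:E)%E.
Proof.
elim: j n h => [|j IH] n h sh.
  rewrite addn0 /= /ind; case: (boolP (Phi h)) => Ph.
    rewrite mule1; congr (P _); apply/seteqP; split => w /=; first by case.
    by move=> E; rewrite E.
  rewrite mule0 (_ : [set _ | _] = set0) ?measure0 //.
  by apply/seteqP; split => // w /= [E]; rewrite E (negbTE Ph).
pose F i := [set w | hist n.+1 w = i :: h /\ Phi (hist (n.+1 + j) w)].
have -> : [set w | hist n w = h /\ Phi (hist (n + j.+1) w)] =
    \big[setU/set0]_(1 <= i < n.+2) F i.
  rewrite -bigcup_seq; apply/seteqP; split => w /=.
    rewrite addnS => -[E Pw]; exists (c n.+1 w).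
      by rewrite /= mem_index_iota; have := c_range w (ltn0Sn n); lia.
    by split => //=; congr (_ :: _).
  by move=> [i _] [] /= [_ E] Pw; rewrite addnS.
have mF i : measurable (F i).
  by apply: measurableI; [apply: measurable_hist_eq | apply: (measurable_hist _ Phi)].
have tF : trivIset setT F.
  by move=> i i' _ _ [w /= [[[<- _] _] [[<- _] _]]].
rewrite big_add1 /= big_mkord (measure_bigsetU P (fun i => mF i.+1)); last first.
  by move=> i i' _ _ /tF-/(_ I I) [].
rewrite -(big_mkord xpredT (fun i => P (F i.+1))) -(big_add1 _ _ _ n.+2 xpredT (fun i => P (F i))).
have [p pE] : exists p, P [set w | hist n w = h] = p%:E.
  exists (fine (P [set w | hist n w = h])).
  by rewrite fineK // fin_num_measure //; apply: measurable_hist_eq.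
rewrite (eq_big_nat _ _ (F2 := fun i => (p * (mean j (ind R Phi) (i :: h) / n.+1%:R))%:E)).
  by rewrite sumEFin pE -EFinM /= sh mulr_suml mulr_sumr.
move=> i Hi; rewrite /F IH /= ?sh // prob_hist_cons // pE -!EFinM.
by congr EFin; ring.
Qed.

Lemma prob_hist n (Phi : pred (seq nat)) :
  P [set w | Phi (hist n w)] = (mean n (ind R Phi) [::])%:E.
Proof.
have := @prob_hist_ext 0 n [::] Phi erefl; rewrite add0n.
rewrite [in X in _ = X -> _](_ : [set w | hist 0 w = [::]] = setT); last first.
  by apply/seteqP; split.
rewrite probability_setT mul1e => <-; congr (P _).
by apply/seteqP; split => w //= [].
Qed.

(** Continuity from below: the events that [Phi] has occurred by time m + n increase with n. *)
Lemma prob_ever_le m (Phi : pred (seq nat)) (b : R) :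
  (forall n, (m <= n)%N -> mean n (ind R (ever m Phi)) [::] <= b) ->
  (P [set w | exists2 n, (m <= n)%N & Phi (hist n w)] <= b%:E)%E.
Proof.
move=> Hb; pose F n := [set w | ever m Phi (hist (m + n) w)].
have mF n : measurable (F n) by apply: (measurable_hist _ (fun h => ever m Phi h)).
have -> : [set w | exists2 n, (m <= n)%N & Phi (hist n w)] = \bigcup_n F n.
  apply/seteqP; split => w /=.
    move=> [n mn Pn]; exists (n - m)%N => //; rewrite /F /= subnKC //.
    apply/everP; exists 0%N => //.
    by rewrite size_hist mn drop0.
  move=> [n _ /everP[k]]; rewrite size_hist addKn => kn /andP[_ Pk].
  exists (m + n - k)%N; first lia.
  have E := @drop_hist _ (fun k => c k : Omega -> nat) (m + n - k) (m + n) w (leq_subr _ _).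
  by rewrite /hist -E (_ : (m + n - (m + n - k) = k)%N) //; lia.
have mU : measurable (\bigcup_n F n) by apply: bigcupT_measurable.
have ndF : nondecreasing_seq F.
  apply/nondecreasing_seqP => n; apply/subsetPset => w; rewrite /F /= addnS /=.
  by rewrite ever_cons ?size_hist ?leq_addr // => ->; rewrite orbT.
have cF := @nondecreasing_cvg_mu _ _ _ P _ mF mU ndF.
rewrite -(cvg_lim _ cF) //; apply: lime_le; first exact: (cvgP _ cF).
apply: nearW => n /=; rewrite /F prob_hist lee_fin; apply: Hb; exact: leq_addr.
Qed.

Lemma small_negligible (A : set Omega) :
  (forall eta : R, 0 < eta -> exists2 B, A `<=` B & measurable B /\ (P B <= eta%:E)%E) ->
  P.-negligible A.
Proof.
move=> HA.
have /choice[B HB] : forall k : nat, exists B, A `<=` B /\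
    (measurable B /\ (P B <= (k.+1%:R^-1)%:E)%E).
  move=> k; have kp : 0 < k.+1%:R^-1 :> R by rewrite invr_gt0 ltr0n.
  by have [B AB mB] := HA _ kp; exists B.
have mI : measurable (\bigcap_k B k).
  by apply: bigcapT_measurable => k; have [_ []] := HB k.
exists (\bigcap_k B k); split => //; last first.
  by move=> w Aw k _; have [+ _] := HB k; apply.
apply/eqP; rewrite -measure_le0; apply/lee_addgt0Pr => e e0; rewrite add0e.
have [k ke] : exists k : nat, k.+1%:R^-1 <= e.
  exists (Num.bound e^-1); rewrite invf_ple ?posrE // ltW //.
  apply: lt_trans (archi_boundP _) _; first by rewrite invr_ge0 ltW.
  by rewrite ltr_nat.
have [_ [mB PB]] := HB k.
apply: le_trans (le_trans PB _); last by rewrite lee_fin.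
by apply: le_measure; rewrite ?inE //; apply: bigcap_inf.
Qed.

End RandomTree.

(** * From subtree sizes to an eventually constant rank, for a single growing tree *)

Section Deterministic.
Local Open Scope nat_scope.

(** In the product of S(a) / (N - S(a)) over the path, ancestors from [V] on contribute factors
    below 1, and the fewer than V others at most K each. The factor of [u] is below K^-V, since 2
    K^V S(u) < N gives K^V S(u) < N - S(u). *)
Lemma light_not_beats h V K u : valid h -> 1 < u <= (size h).+1 -> 0 < K ->
  (forall a, V <= a <= (size h).+1 -> 2 * sub_size h a < (size h).+1) ->
  (forall a, 1 < a < V -> a <= (size h).+1 ->
    (size h).+1 <= K * ((size h).+1 - sub_size h a)) ->
  2 * K ^ V * sub_size h u < (size h).+1 ->
  ~~ beats_root h u.
Proof.
move=> Hh Hu K0 HV HK Hlt; set N := (size h).+1 in HV HK Hlt *.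
have Hu0 : 0 < u <= N by lia.
have au := anc_par Hh Hu; have Hs := anc_sub Hh Hu0; have ua := anc_uniq Hh Hu0.
rewrite au in Hs ua.
rewrite /beats_root au !big_cons -/N -ltnNge; set l := anc h (par h u) in Hs ua *.
have lr a : a \in l -> 1 < a <= u by move=> al; apply: Hs; rewrite inE al orbT.
have Q0 : 0 < \prod_(a <- l) (N - sub_size h a).
  rewrite big_seq prodn_cond_gt0 // => a /lr Ha.
  by rewrite subn_gt0 /N ltnS; apply: sub_size_ltn => //; lia.
have PQ : \prod_(a <- l) sub_size h a <= K ^ V * \prod_(a <- l) (N - sub_size h a).
  apply: (@leq_trans (\prod_(a <- l) ((if a < V then K else 1) * (N - sub_size h a)))).
    rewrite big_seq [leqRHS]big_seq; apply: leq_prod => a /lr Ha.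
    case: ltnP => aV; last by have := HV a; rewrite /N; lia.
    by apply: leq_trans (sub_size_le h a) _; apply: HK; lia.
  rewrite big_split /= leq_mul2r; apply/orP; right.
  rewrite -big_mkcond /= big_const_seq iter_muln_1 leq_pexp2l //.
  rewrite -size_filter -[leqRHS](size_iota 0); apply: uniq_leq_size.
    by rewrite filter_uniq //; case/andP: ua.
  by move=> a; rewrite mem_filter mem_iota => /andP[].
have KV : 0 < K ^ V by rewrite expn_gt0 K0.
apply: leq_ltn_trans (_ : _ <= sub_size h u * (K ^ V * \prod_(a <- l) (N - sub_size h a))) _.
  by rewrite leq_mul2l PQ orbT.
rewrite mulnA ltn_mul2r Q0 /= mulnC; nia.
Qed.

Lemma uniform_bound (Q : nat -> nat -> nat -> Prop) V :
  (forall v K n0 K' n0', K <= K' -> n0 <= n0' -> Q v K n0 -> Q v K' n0') ->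
  (forall v, 1 < v -> exists K n0, Q v K n0) ->
  exists K n0, forall v, 1 < v < V -> Q v K n0.
Proof.
move=> mono HQ; elim: V => [|V [K [n0 IH]]]; first by exists 0, 0; lia.
have [V1|V1] := leqP V 1; first by exists 0, 0; lia.
have [K' [n0' H]] := HQ V V1; exists (maxn K K'), (maxn n0 n0') => v Hv.
have [->|vV] := eqVneq v V; first by apply: mono H; lia.
by apply: mono (IH v _); lia.
Qed.

Lemma rank_eventually (hh : nat -> seq nat) :
  (forall n, valid (hh n)) -> (forall n, size (hh n) = n) ->
  (forall q, exists V, forall n v, V <= v <= n.+1 -> q * sub_size (hh n) v < n.+1) ->
  (forall v, 1 < v -> exists K n0 b, forall n, n0 <= n ->
    beats_root (hh n) v = b /\ n.+1 <= K * (n.+1 - sub_size (hh n) v)) ->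
  exists m k, forall n, m <= n -> rumor_rank (rtree (hh n)) 1 = k.
Proof.
move=> Hval Hsz HA HB.
have [V HV] := HA 2.
have [K [n0 HK]] : exists K n0, forall v, 1 < v < V -> forall n, n0 <= n ->
    n.+1 <= K * (n.+1 - sub_size (hh n) v).
  apply: (uniform_bound (Q := fun v K n0 => forall n, n0 <= n ->
    n.+1 <= K * (n.+1 - sub_size (hh n) v))).
    move=> v K n0 K' n0' KK nn H n n0n; apply: leq_trans (H n _) _; first lia.
    by rewrite leq_mul2r KK orbT.
  by move=> v /HB[K [n0 [b H]]]; exists K, n0 => n /H[].
(* By [light_not_beats] no vertex from [V'] on can compete; [K.+1] guarantees positivity. *)
have [V' HV'] := HA (2 * K.+1 ^ V).
have /choice[f Hf] : forall v, exists b, 1 < v ->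
    exists n0, forall n, n0 <= n -> beats_root (hh n) v = b.
  move=> v; have [v1|v1] := ltnP 1 v; last by exists true; lia.
  have [K' [n1 [b H]]] := HB v v1; exists b => _; exists n1 => n /H[] //.
have [_ [n1 Hn1]] : exists K' n1 : nat, forall v, 1 < v < V'.+1 ->
    forall n, n1 <= n -> beats_root (hh n) v = f v.
  apply: (uniform_bound (Q := fun v _ n1 =>
    forall n, n1 <= n -> beats_root (hh n) v = f v)).
    by move=> v _ m _ m' _ mm H n Hn; apply: H; lia.
  by move=> v /Hf[m Hm]; exists 0, m.
(* After this time the comparisons below [V'] have reached their final values [f], the bounds by [K]
   hold, and labels 1, ..., V' are all present. *)
exists (n0 + n1 + V'), (count (fun u => (u != 1) && f u) (iota 1 V')).+1 => n Hn.
rewrite rumor_rank_root // Hsz; congr S.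
rewrite -(@subnKC V' n.+1); last by lia.
rewrite iotaD count_cat -[RHS]addn0; congr (_ + _).
  apply: eq_in_count => u; rewrite mem_iota => Hu.
  by case: eqVneq => //= u1; apply: Hn1; lia.
apply/eqP; rewrite -leqn0 leqNgt -has_count; apply/hasPn => u; rewrite mem_iota => Hu.
case: eqVneq => //= u1; apply: (@light_not_beats _ V K.+1); rewrite ?Hsz //.
- lia.
- by move=> a Ha; apply: HV.
- move=> a aV _; apply: leq_trans (HK a aV n _) _; first lia.
  by rewrite leq_mul2r leqnSn orbT.
- by apply: HV'; lia.
Qed.

End Deterministic.

(** * Almost sure validity of the deterministic hypotheses *)

Section AlmostSure.
Context (d : measure_display) (Omega : measurableType d) (R : realType).
Variables (P : probability Omega R) (c : nat -> {RV P >-> nat}).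
Hypothesis c_range : forall n w, (0 < n)%N -> (1 <= c n w <= n)%N.
Hypothesis c_unif : forall n i, (1 <= i <= n)%N ->
  P [set w | c n w = i] = (n%:R^-1)%:E.
Hypothesis c_indep : forall n (i : nat) A, (0 < n)%N -> past c n A ->
  P ([set w | c n w = i] `&` A) = (P [set w | c n w = i] * P A)%E.

Let hist n w := hist (fun k => c k : Omega -> nat) n w.

Lemma late_light q : P.-negligible [set w | ~ exists V, forall n v,
  (V <= v <= n.+1)%N -> (q * sub_size (hist n w) v < n.+1)%N].
Proof.
have [->|q0] := posnP q.
  apply: negligibleS (@negligible_set0 _ _ _ P) => w /=; apply.
  by exists 0%N => n v _; rewrite mul0n.
apply: small_negligible => eta eta0.
(* [mean_late_large] gives the bound 4 q^2 / (m + 2), which this choice makes at most eta. *)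
pose a : R := 4 * q%:R ^+ 2 / eta; pose m := Num.bound a.
have a0 : 0 <= a by rewrite divr_ge0 ?mulr_ge0 ?exprn_ge0 // ltW.
exists [set w | exists2 n, (m <= n)%N & late_large m q (hist n w)]; last first.
  split.
    rewrite (_ : [set _ | _] = \bigcup_n [set w | (m <= n)%N /\ late_large m q (hist n w)]).
      apply: bigcupT_measurable => n.
      exact: (@measurable_hist _ _ _ P c n (fun h => (m <= n)%N /\ late_large m q h)).
    by apply/seteqP; split => w /= [n]; [exists n | move=> _ []; exists n].
  apply: prob_ever_le => // n mn; have -> : n = (m + (n - m))%N by lia.
  rewrite mean_add -[leRHS](mean_cst m eta [::]); apply: mean_le => // h sh.
  rewrite cats0 => Hh.
  have := @mean_late_large R q h (n - m) q0 Hh; rewrite sh => /le_trans; apply.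
  rewrite invrK (_ : _ * _ = 4 * q%:R ^+ 2 / m.+2%:R); last by ring.
  have : a <= m.+2%:R.
    by apply: le_trans (ltW (archi_boundP a0)) _; rewrite ler_nat /m; lia.
  by rewrite /a !ler_pdivrMr ?ltr0n // [eta * _]mulrC.
move=> w /= nV; apply: contrapT => nB; apply: nV; exists m.+2 => n v Hv.
rewrite ltnNge; apply/negP => H; apply: nB; exists n; first lia.
rewrite /late_large /hist size_hist; apply/hasP; exists v => //.
by rewrite mem_index_iota; lia.
Qed.

Lemma eventually_settled v : (1 < v)%N -> P.-negligible [set w |
  ~ exists K n0 b, forall n, (n0 <= n)%N -> beats_root (hist n w) v = b /\
     (n.+1 <= K * (n.+1 - sub_size (hist n w) v))%N].
Proof.
move=> v1; apply: small_negligible => eta eta0.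
have eta2 : 0 < eta / 2 by rewrite divr_gt0.
have [K [n0 [K1 vn0 HU HD]]] := settling v1 eta2.
(* Outside [B1], unsettled at time [n0], and [B2], too much drift afterwards, [settled_stable]
   applies at every later time. *)
pose B1 := [set w | unsettled R v K (hist n0 w)].
pose B2 := [set w | exists2 n, (n0 <= n)%N & drift_event R v K n0 (hist n w)].
have mB1 : measurable B1.
  exact: (@measurable_hist _ _ _ P c n0 (fun h => unsettled R v K h)).
have mB2 : measurable B2.
  rewrite (_ : B2 = \bigcup_n [set w | (n0 <= n)%N /\ drift_event R v K n0 (hist n w)]).
    apply: bigcupT_measurable => n.
    exact: (@measurable_hist _ _ _ P c n (fun h => (n0 <= n)%N /\ drift_event R v K n0 h)).
  by apply/seteqP; split => w /= [n]; [exists n | move=> _ []; exists n].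
have pB1 : (P B1 <= (eta / 2)%:E)%E.
  have := prob_hist c_range c_unif c_indep n0 (unsettled R v K).
  by rewrite -/B1 => ->; rewrite lee_fin.
have pB2 : (P B2 <= (eta / 2)%:E)%E by apply: prob_ever_le.
exists (B1 `|` B2); last first.
  split; first exact: measurableU.
  apply: le_trans (measureU2 _ mB1 mB2) _; rewrite [eta]splitr EFinD.
  exact: leeD.
move=> w /= nV; apply: contrapT => nB; apply: nV.
have nU : ~~ unsettled R v K (hist n0 w) by apply/negP => H; apply: nB; left.
exists (2 * K)%N, n0, (beats_root (hist n0 w) v) => n nn.
have nD : ~~ drift_event R v K n0 (hist n w).
  by apply/negP => H; apply: nB; right; exists n.
have dE := @drop_hist _ (fun k => c k : Omega -> nat) n0 n w nn.
have hE : hist n w = take (n - n0) (hist n w) ++ hist n0 w.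
  by rewrite /hist -dE cat_take_drop.
have vH : valid (hist n w) by apply: valid_hist.
have sn k : size (hist k w) = k by apply: size_hist.
have := @settled_stable R v K (take (n - n0) (hist n w)) (hist n0 w).
rewrite -hE !sn; apply => //; first lia.
move: nD; rewrite /drift_event sn {2}/hist dE.
by rewrite {1}hE anc_cat // sn; lia.
Qed.

Lemma root_rank_eventually_constant : P.-negligible [set w |
  ~ exists m k, forall n, (m <= n)%N -> rumor_rank (rtree (hist n w)) 1%N = k].
Proof.
have NA := negligible_bigcup late_light.
have NB : P.-negligible (\bigcup_v (if (1 < v)%N then [set w |
  ~ exists K n0 b, forall n, (n0 <= n)%N -> beats_root (hist n w) v = b /\
     (n.+1 <= K * (n.+1 - sub_size (hist n w) v))%N] else set0)).
  apply: negligible_bigcup => v; case: ifP => [v1|_]; last exact: negligible_set0.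
  exact: eventually_settled.
apply: negligibleS (negligibleU NA NB) => w /= nR.
apply: contrapT => /not_orP[nA nB]; apply: nR.
apply: (@rank_eventually (fun n => hist n w)).
- by move=> n; apply: valid_hist.
- by move=> n; apply: size_hist.
- by move=> q; apply: contrapT => H; apply: nA; exists q.
- by move=> v v1; apply: contrapT => H; apply: nB; exists v => //; rewrite v1.
Qed.

End AlmostSure.

Lemma measurable_countable_comp d d' (S : measurableType d) (U : measurableType d')
    (I : countType) (F : S -> I) (g : I -> U) :
  (forall i, measurable [set w | F w = i]) -> measurable_fun setT (g \o F).
Proof.
move=> mF _ Y _; rewrite setTI.
rewrite (_ : _ @^-1` _ = \bigcup_i (if `[< Y (g i) >] then [set w | F w = i] else set0)).
  apply: countable_bigcupT_measurable => [|i]; first exact: countableP.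
  by case: ifP.
apply/seteqP; split => [w /= Yw|w [i _]]; first by exists (F w) => //; case: asboolP.
by case: asboolP => // Yi /= ->.
Qed.

(** * Measurable settling time and limit of an eventually constant sequence *)

Section Persistence.
Context (d : measure_display) (Omega : measurableType d) (R : realType).
Variables (P : probability Omega R) (X : nat -> Omega -> nat).
Hypothesis mX : forall n k, measurable [set w | X n w = k].

Let stable m w := forall n, (m <= n)%N -> X n w = X m w.

(** Taking the least time from which the sequence is constant makes the choice canonical, hence
    measurable; [None] stands for never. *)
Let first_stable w : option nat :=
  if pselect (exists m, `[< stable m w >]) is left H then Some (ex_minn H) else None.

Let limit w : option nat := omap (X^~ w) (first_stable w).

Let first_stableP w : match first_stable w with
  | Some m => stable m w /\ forall k, stable k w -> (m <= k)%N
  | None => forall m, ~ stable m w end.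
Proof.
rewrite /first_stable; case: pselect => [H|H].
  case: ex_minnP => m /asboolP sm mmin; split => // k sk.
  by apply: mmin; apply/asboolP.
by move=> m sm; apply: H; exists m; apply/asboolP.
Qed.

Let measurable_stable m : measurable [set w | stable m w].
Proof.
rewrite (_ : [set _ | _] = \bigcap_n (if (m <= n)%N then
   \bigcup_k ([set w | X n w = k] `&` [set w | X m w = k]) else setT)).
  apply: bigcapT_measurable => n; case: ifP => // _.
  by apply: bigcupT_measurable => k; apply: measurableI.
apply/seteqP; split => w /= H n.
  by move=> _; case: ifP => // /H E; exists (X m w).
by move=> mn; have := H n I; rewrite mn => -[k _ [-> ->]].
Qed.

Let measurable_first_stable o : measurable [set w | first_stable w = o].
Proof.
case: o => [m|].
  rewrite (_ : [set _ | _] = [set w | stable m w] `&`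
    \bigcap_k (if (k < m)%N then ~` [set w | stable k w] else setT)).
    apply: measurableI => //; apply: bigcapT_measurable => k.
    by case: ifP => // _; apply: measurableC.
  apply/seteqP; split => w /=.
    move=> E; have := first_stableP w; rewrite E => -[sm mmin]; split => // k _.
    by case: ltnP => // km /mmin; rewrite leqNgt km.
  move=> [sm H]; have := first_stableP w; case: (first_stable w) => [k [sk kmin]|/(_ m)//].
  congr Some; apply/eqP; rewrite eqn_leq kmin //= leqNgt; apply/negP => km.
  by have := H k I; rewrite km; apply.
rewrite (_ : [set _ | _] = \bigcap_k ~` [set w | stable k w]).
  by apply: bigcapT_measurable => k; apply: measurableC.
apply/seteqP; split => w /=.
  by move=> E k _ /=; have := first_stableP w; rewrite E; apply.
by move=> H; have := first_stableP w; case: (first_stable w) => // m [/(H m I)].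
Qed.

Let measurable_limit o : measurable [set w | limit w = o].
Proof.
case: o => [x|]; last first.
  rewrite (_ : [set _ | _] = [set w | first_stable w = None]) //.
  by apply/seteqP; split => w; rewrite /= /limit; case: (first_stable w).
rewrite (_ : [set _ | _] = \bigcup_m ([set w | first_stable w = Some m] `&` [set w | X m w = x])).
  by apply: bigcupT_measurable => m; apply: measurableI.
apply/seteqP; split => w; rewrite /= /limit.
  by case E: (first_stable w) => [m|] //= [<-]; exists m.
by move=> [m _ [/= -> <-]].
Qed.

Lemma persistent_eventually_constant (Y : nat -> Omega -> nat) :
  (forall n w, (0 < n)%N -> Y n w = X n.-1 w) ->
  P.-negligible [set w | ~ exists m k, forall n, (m <= n)%N -> X n w = k] ->
  persistent P Y.
Proof.
move=> YX neg.
(* [None] becomes +oo. For N the finite values are shifted by [succn], because [Y n] is [X n.-1]. *)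
pose ext (f : nat -> nat) (o : option nat) : \bar R :=
  if o is Some m then (f m)%:R%:E else +oo%E.
have mN := measurable_countable_comp (ext succn) measurable_first_stable.
have mK := measurable_countable_comp (ext id) measurable_limit.
pose N : {RV P >-> \bar R} := HB.pack (ext succn \o first_stable)
  (isMeasurableFun.Build _ _ _ _ _ mN).
pose K : {RV P >-> \bar R} := HB.pack (ext id \o limit)
  (isMeasurableFun.Build _ _ _ _ _ mK).
have fin o f : (ext f o < +oo)%E <-> o <> None.
  by case: o => [m|] /=; split => // _; rewrite ltry.
have neg0 : P [set w | first_stable w = None] = 0%E.
  apply: measure_negligible => //; apply: negligibleS neg => w /= E [m [k H]].
  have := first_stableP w; rewrite E => /(_ m); apply => n mn.
  by rewrite !H.
have P1 : P [set w | first_stable w <> None] = 1%E.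
  have := probability_setC P (measurable_first_stable None).
  by rewrite neg0 sube0.
have int_ext f o : int_or_pinfty (ext f o).
  by case: o => [m|]; [right; exists (f m)%:Z | left].
exists N, K; split.
- by move=> w; split; apply: int_ext.
- rewrite -P1; congr (P _); apply/seteqP; split => w /=; first by move/fin.
  by move=> H; apply/fin.
- rewrite -P1; congr (P _); apply/seteqP; split => w /=.
    by move/fin; rewrite /limit; case: (first_stable w).
  by move=> H; apply/fin; move: H; rewrite /limit; case: (first_stable w).
- move=> w n n0; rewrite YX //= /limit; have := first_stableP w.
  case: (first_stable w) => [m [sm _]|_] /=; last by rewrite leye_eq.
  by rewrite lee_fin ler_nat => mn; rewrite sm //; lia.
Qed.

End Persistence.

Local Close Scope classical_set_scope.
Local Close Scope ring_scope.

Theorem theorem30 (d : measure_display) (Omega : measurableType d)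
    (R : realType) (P : probability Omega R) (T : nat -> Omega -> graph) :
  is_urrt P T -> persistent P (fun n w => rumor_rank (T n w) 1).
Proof.
move=> [c [c_range c_unif c_indep T1 TS]].
(* A tree on n + 1 vertices has a history of length n, whence the shift in the index. *)
have TE n w : T n.+1 w = rtree (hist (fun k => c k : Omega -> nat) n w).
  by elim: n => [|n IH]; [exact: T1 | rewrite TS // IH /= size_hist].
apply: (persistent_eventually_constant _ _
  (root_rank_eventually_constant c_range c_unif c_indep)).
- by move=> n k; exact: (@measurable_hist _ _ _ P c n (fun h => rumor_rank (rtree h) 1 = k)).
- by move=> [//|n] w _; rewrite TE.
Qed.
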